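(* There exist an absolute constant $K>0$ and a function $f$ from the positive integers to the positive integers with $f(c)\le Kc^2$ for every $c$ (i.e. $f(c)=O(c^2)$) such that the following holds. For every positive integer $c$, if $n>10f(c)$ and $P$ is a finite poset with $|P|\le 2n+1$ and $\dim(P)\ge n-c$, then $P$ contains a standard example $S_d$ with $d\ge n-f(c)$.
   Context: The dimension $\dim(P)$ of a finite poset $P$ is the least positive integer $d$ such that $P$ is the intersection of $d$ linear extensions of $P$ (i.e. there are linear extensions $L_1,\dots,L_d$ with $x<y$ in $P$ iff $x<y$ in every $L_i$). For an integer $d\ge 2$, the standard example $S_d$ is the height-2 poset with minimal elements $a_1,\dots,a_d$ and maximal elements $b_1,\dots,b_d$, where $a_i<b_j$ if and only if $i\ne j$. ''$P$ contains $S_d$'' means $P$ has a subposet isomorphic to $S_d$. *)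

(* Defs.v *)
From HB Require Import structures.
From mathcomp Require Import all_boot all_order.

Set Implicit Arguments.
Unset Strict Implicit.
Unset Printing Implicit Defensive.

Import Order.TTheory.
Local Open Scope order_scope.

Section Dimension.
Variables (disp : Order.disp_t) (P : finPOrderType disp).
Implicit Types L : {set P * P}.

(* Orders are handled through their strict part: [(x, y) \in L] means that x  *)
(* lies strictly below y in L.                                                *)
Definition linear_extension L : bool :=
  [&& [forall x, (x, x) \notin L],
      [forall x, forall y, forall z,
         ((x, y) \in L) ==> ((y, z) \in L) ==> ((x, z) \in L)],
      [forall x, forall y, (x != y) ==> ((x, y) \in L) || ((y, x) \in L)]
    & [forall x, forall y, (x < y) ==> ((x, y) \in L)]].

Definition realizer (d : nat) (L : {ffun 'I_d -> {set P * P}}) : bool :=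
  [forall i, linear_extension (L i)] &&
  [forall x, forall y, (x < y) == [forall i, (x, y) \in L i]].

Definition has_realizer (d : nat) : bool :=
  (0 < d)%N && [exists L : {ffun 'I_d -> {set P * P}}, realizer L].

Lemma linear_extensionP L :
  reflect [/\ forall x, (x, x) \notin L,
              forall x y z, (x, y) \in L -> (y, z) \in L -> (x, z) \in L,
              forall x y, x != y -> (x, y) \in L \/ (y, x) \in L
            & forall x y, x < y -> (x, y) \in L]
          (linear_extension L).
Proof.
apply: (iffP and4P) => -[irr tr tot ext]; split.
- by move=> x; move/forallP: irr; apply.
- move=> x y z Lxy Lyz; move/forallP/(_ x)/forallP/(_ y)/forallP/(_ z): tr.
  by rewrite Lxy Lyz.
- move=> x y nxy; move/forallP/(_ x)/forallP/(_ y): tot.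
  by rewrite nxy /= => /orP.
- by move=> x y xy; move/forallP/(_ x)/forallP/(_ y): ext; rewrite xy.
- by apply/forallP.
- apply/forallP=> x; apply/forallP=> y; apply/forallP=> z.
  by apply/implyP=> Lxy; apply/implyP; apply: tr.
- by apply/forallP=> x; apply/forallP=> y; apply/implyP=> /tot/orP.
- by apply/forallP=> x; apply/forallP=> y; apply/implyP; apply: ext.
Qed.

Lemma szpilrajn (S : {set P * P}) :
    (forall x, (x, x) \notin S) ->
    (forall x y z, (x, y) \in S -> (y, z) \in S -> (x, z) \in S) ->
    (forall x y, x < y -> (x, y) \in S) ->
  exists2 L : {set P * P}, linear_extension L & S \subset L.
Proof.
have [n] := ubnP #|~: S|; elim: n S => // n IHn S ltSn irr tr ext.
have [/forallP tot|] :=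
    boolP [forall x, forall y, (x != y) ==> ((x, y) \in S) || ((y, x) \in S)].
  exists S => //; apply/linear_extensionP; split=> // x y nxy.
  by move/forallP/(_ y): (tot x); rewrite nxy => /orP.
case/forallPn=> x /forallPn[y]; rewrite negb_imply negb_or.
case/and3P=> nxy nSxy nSyx.
pose le u v := (u == v) || ((u, v) \in S).
have leS u v w : le u v -> (v, w) \in S -> (u, w) \in S.
  by case/orP=> [/eqP-> //|]; apply: tr.
have Sle u v w : (u, v) \in S -> le v w -> (u, w) \in S.
  by move=> Suv /orP[/eqP<- //|]; apply: tr.
have lele u v w : le u v -> le v w -> le u w.
  by case/orP=> [/eqP-> //|Suv vw]; rewrite /le (Sle _ _ _ Suv vw) orbT.
have nle : ~~ le y x by rewrite /le negb_or eq_sym nxy nSyx.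
pose S' := [set p : P * P | (p \in S) || le p.1 x && le y p.2].
have [||||L linL sub] := IHn S'.
- rewrite -ltnS; apply: leq_trans ltSn; rewrite ltnS.
  apply/proper_card; rewrite properE; apply/andP; split.
    by apply/subsetP=> p; rewrite !inE; apply: contra => ->.
  apply/subsetPn; exists (x, y); first by rewrite inE.
  by rewrite !inE /le !eqxx orbT.
- move=> u; rewrite inE negb_or irr /=; apply/negP=> /andP[ux yu].
  by case/negP: nle; apply: lele yu ux.
- move=> u v w; rewrite !inE /= => /orP[Suv|/andP[ux yv]] /orP[Svw|/andP[vx yw]].
  + by rewrite (tr _ _ _ Suv Svw).
  + by rewrite /le (Sle _ _ _ Suv vx) orbT -/(le y w) yw orbT.
  + by rewrite ux [le y w]/le (@leS y v w) ?orbT.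
  + by case/negP: nle; apply: lele yv vx.
- by move=> u v /ext; rewrite inE => ->.
- exists L => //; apply: subset_trans sub.
  by apply/subsetP=> p; rewrite inE => ->.
Qed.

Lemma ex_realizer : exists d, has_realizer d.
Proof.
pose S0 := [set p : P * P | p.1 < p.2].
pose A := [set L | linear_extension L].
have sep x y : ~~ (x < y) -> exists2 L, L \in A & (x, y) \notin L.
  move=> nxy; have [-> | neq_xy] := eqVneq x y.
    have [||| L linL _] := @szpilrajn S0.
    - by move=> u; rewrite inE /= ltxx.
    - by move=> u v w; rewrite !inE; apply: lt_trans.
    - by move=> u v; rewrite inE.
    by exists L; rewrite ?inE //; case/linear_extensionP: linL.
  have nle : ~~ (x <= y) by rewrite le_eqVlt negb_or neq_xy.
  pose S := [set p : P * P | (p.1 < p.2) || (p.1 <= y) && (x <= p.2)].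
  have [||| L linL sub] := @szpilrajn S.
  - move=> u; rewrite inE ltxx /=; apply/negP=> /andP[uy xu].
    by case/negP: nle; apply: le_trans xu uy.
  - move=> u v w; rewrite !inE /= => /orP[uv|/andP[uy xv]] /orP[vw|/andP[vy xw]].
    + by rewrite (lt_trans uv vw).
    + by rewrite (le_trans (ltW uv) vy) xw orbT.
    + by rewrite uy (le_trans xv (ltW vw)) orbT.
    + by case/negP: nle; apply: le_trans xv vy.
  - by move=> u v uv; rewrite inE uv.
  exists L; rewrite ?inE //; apply/negP=> Lxy.
  have Lyx : (y, x) \in L by apply: (subsetP sub); rewrite inE /= !lexx orbT.
  by case/linear_extensionP: linL => irr tr _ _; case/negP: (irr x); apply: tr Lyx.
have [L0 L0A] : exists L0, L0 \in A.
  have [||| L linL _] := @szpilrajn S0; last by exists L; rewrite inE.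
  - by move=> u; rewrite inE /= ltxx.
  - by move=> u v w; rewrite !inE; apply: lt_trans.
  - by move=> u v; rewrite inE.
exists #|A|; apply/andP; split; first by apply/card_gt0P; exists L0.
have linA i : linear_extension (@enum_val _ (mem A) i).
  by have := enum_valP i; rewrite inE.
apply/existsP; exists [ffun i => enum_val i]; apply/andP; split.
  by apply/forallP=> i; rewrite ffunE.
apply/forallP=> x; apply/forallP=> y; apply/eqP.
have [xy|/sep[L LA nL]] := boolP (x < y).
  apply/esym/forallP=> i; rewrite ffunE.
  by case/linear_extensionP: (linA i) => _ _ _; apply.
apply/esym/negbTE/forallPn; exists (enum_rank_in L0A L).
by rewrite ffunE enum_rankK_in.
Qed.

Definition poset_dim : nat := ex_minn ex_realizer.

End Dimension.
Arguments poset_dim {disp} P.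

Fact standard_example_display : Order.disp_t. Proof. exact: Order.Disp tt tt. Qed.

(* [inl i] is the minimal element a_i and [inr j] the maximal element b_j.    *)
Definition standard_example (d : nat) : Type := ('I_d + 'I_d)%type.

HB.instance Definition _ d := Finite.on (standard_example d).

Definition standard_example_le d (x y : standard_example d) : bool :=
  match x, y with
  | inl i, inr j => i != j
  | _, _ => x == y
  end.

Fact standard_example_le_refl d : reflexive (@standard_example_le d).
Proof. by case=> i /=. Qed.

Fact standard_example_le_anti d : antisymmetric (@standard_example_le d).
Proof. by case=> i [] j //= /andP[/eqP]. Qed.

Fact standard_example_le_trans d : transitive (@standard_example_le d).
Proof.
case=> j [] i [] k //=.
- by move=> /eqP[->].
- by move=> /eqP[->].
- by move=> ij /eqP[<-].
- by move=> /eqP[->].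
Qed.

HB.instance Definition _ d :=
  Order.Le_isPOrder.Build standard_example_display (standard_example d)
    (@standard_example_le_refl d) (@standard_example_le_anti d)
    (@standard_example_le_trans d).

Definition contains_poset (disp1 disp2 : Order.disp_t)
    (P : porderType disp1) (Q : porderType disp2) : Prop :=
  exists2 f : Q -> P, injective f & {mono f : x y / x <= y}.

(* Main.v *)
Require Import Defs.
From mathcomp Require Import all_boot all_order zify.

(** A linear extension is described by a weakly monotone map to [nat]; the
    length of any list of such maps reversing every incomparable pair bounds
    the dimension.

    Since dim <= width, a poset on about 2n points with dimension close to n
    has an antichain A of about n points.  Let U and D be the sets of points
    above and below A.  One extension can push u in U down and d in D up at
    the same time, so if both U and D had many elements there would be a short
    realizer; hence one of them, say D, has O(c) elements.  Two comparable
    elements of U can also share an extension, so after deleting O(c) elements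
    U is an antichain and the poset has height two.

    The height-two case is about covering the bipartite incomparability graph
    by chain graphs (nested neighbourhoods).  The edges at u, the edges at an
    incomparable v, and the edges from a third vertex a to the common
    neighbours of a and u form one chain graph.  By König's theorem the graph
    has a matching (a_i, b_i) covering all but O(c) vertices.  Take a maximal
    set of m disjoint pairs i, j with a_i incomparable to b_j; the unused
    indices give a standard example, so it is enough that m = O(c^2).  If m is
    larger, consider the graph between the vertices a_j and the vertices b_i:
    either k = O(c) of the pairs (i, j) are independent and each saves one
    chain graph, or the graph is so dense that it has enough 4-cycles to let
    k vertices of one side be served as third vertices, so that k vertices on
    each side need not be centres, which again saves k chain graphs. *)

Set Implicit Arguments.
Unset Strict Implicit.
Unset Printing Implicit Defensive.

(** * Matchings and König's theorem *)

Lemma exists_subset_card (V : finType) (X : {set V}) n :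
  n <= #|X| -> exists2 Y : {set V}, Y \subset X & #|Y| = n.
Proof.
move=> le_n; exists [set x in take n (enum X)].
  by apply/subsetP=> x; rewrite inE => /mem_take; rewrite mem_enum.
rewrite cardsE (card_uniqP _) ?take_uniq ?enum_uniq //.
by rewrite size_takel // -cardE.
Qed.

(** [uniq (ends s)] expresses that the pairs in [s] are vertex-disjoint; it also excludes pairs with
    two equal entries. *)
Definition ends (V : Type) (s : seq (V * V)) := unzip1 s ++ unzip2 s.

Lemma size_ends (V : Type) (s : seq (V * V)) : size (ends s) = (size s).*2.
Proof. by rewrite size_cat !size_map addnn. Qed.

Lemma maximal_matching (V : finType) (E : rel V) : irreflexive E ->
  exists s : seq (V * V),
    [/\ all (fun p => E p.1 p.2) s, uniq (ends s)
      & forall x y, E x y -> (x \in ends s) || (y \in ends s)].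
Proof.
move=> irr.
(* Greedy extension with fuel [n]: distinct endpoints number at most [#|V|], so the fuel cannot run
   out before [s] is maximal. *)
suff H n (s : seq (V * V)) : #|V| < size (ends s) + n ->
    all (fun p => E p.1 p.2) s -> uniq (ends s) -> exists s : seq (V * V),
    [/\ all (fun p => E p.1 p.2) s, uniq (ends s)
      & forall x y, E x y -> (x \in ends s) || (y \in ends s)].
  by apply: (H #|V|.+1 [::]).
elim: n s => [|n IHn] s lt_n Es us.
  by move: lt_n; rewrite addn0 -(card_uniqP us) ltnNge max_card.
case: (boolP [exists x, exists y, [&& E x y, x \notin ends s & y \notin ends s]]).
  case/existsP=> x /existsP[y /and3P[Exy xs ys]].
  have nxy : x != y by apply: contraTneq Exy => ->; rewrite irr.
  apply: (IHn ((x, y) :: s)).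
  - by move: lt_n; rewrite !size_ends /=; lia.
  - by rewrite /= Exy.
  - rewrite /ends /= -[y :: _]cat1s uniq_catCA cat1s /= mem_cat inE orbCA.
    by rewrite -mem_cat negb_or nxy xs ys.
move/existsPn=> nE; exists s; split=> // x y Exy.
move/existsPn: (nE x) => /(_ y); rewrite Exy /= negb_and !negbK.
by [].
Qed.

Section Konig.
Variables S T : finType.
Implicit Types (E M : {set S * T}) (X : {set S}) (Y : {set T}).

Definition matching M := {in M &, injective fst} /\ {in M &, injective snd}.

Definition vertex_cover E X Y :=
  [forall p in E, (p.1 \in X) || (p.2 \in Y)].

Lemma vertex_coverP E X Y :
  reflect (forall p, p \in E -> (p.1 \in X) || (p.2 \in Y)) (vertex_cover E X Y).
Proof. exact: 'forall_implyP. Qed.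

Lemma vertex_cover_add E X Y p : vertex_cover (E :\ p) X Y ->
  (p.1 \in X) || (p.2 \in Y) -> vertex_cover E X Y.
Proof.
move=> /vertex_coverP cov pXY; apply/vertex_coverP=> r rE.
by have [-> //|nrp] := eqVneq r p; apply: cov; rewrite !inE nrp.
Qed.

(** The hard half of König's theorem. An edge is deleted as long as this creates no cover with fewer
    than [n] vertices, which is what [critical] tests; a graph in which no edge can be deleted is
    itself a matching. *)
Lemma matching_of_covers n E :
  (forall X Y, vertex_cover E X Y -> n <= #|X| + #|Y|) ->
  exists M : {set S * T}, [/\ M \subset E, matching M & n <= #|M|].
Proof.
have [m] := ubnP #|E|; elim: m E => // m IHm E ltm cov.
pose critical e := [forall X, forall Y,
  vertex_cover (E :\ e) X Y ==> (n <= #|X| + #|Y|)].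
case: (boolP [exists e in E, critical e]) => [/exists_inP[e eE /forallP ce]|].
  have [||M [sME Mm nM]] := IHm (E :\ e).
  - by move: ltm; rewrite (cardsD1 e E) eE; lia.
  - by move=> X Y cXY; move/forallP/(_ Y): (ce X); rewrite cXY.
  by exists M; split=> //; apply: subset_trans sME (subD1set _ _).
rewrite negb_exists_in => /forall_inP nc.
have small e : e \in E -> exists X, exists Y,
    [/\ vertex_cover (E :\ e) X Y, #|X| + #|Y| < n, e.1 \notin X & e.2 \notin Y].
  move=> eE; case/forallPn: (nc e eE) => X /forallPn[Y].
  rewrite negb_imply -ltnNge => /andP[cXY lt]; exists X, Y.
  suff /norP[-> ->] : ~~ ((e.1 \in X) || (e.2 \in Y)) by [].
  apply: contraTN lt => eXY; rewrite -leqNgt; apply: cov.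
  exact: vertex_cover_add eXY.
have other e f X Y : vertex_cover (E :\ e) X Y -> f \in E -> f != e ->
    (f.1 \in X) || (f.2 \in Y).
  by move=> /vertex_coverP c fE nfe; apply: c; rewrite !inE nfe.
exists E; split=> //; last first.
  apply: leq_trans (cov [set p.1 | p in E] set0 _) _.
    by apply/vertex_coverP=> p pE; rewrite imset_f.
  by rewrite cards0 addn0 leq_imset_card.
(* Two edges at a common vertex contradict edge-minimality: uncrossing the  *)
(* two smaller covers gives a cover of E and one missing only that vertex.  *)
split=> e f eE fE efeq; apply/eqP; apply: contraT => nef.
- have [X [Y [c lt nX nY]]] := small e eE.
  have [X' [Y' [c' lt' nX' nY']]] := small f fE.
  have Ye : f.2 \in Y.
    by have := other _ _ _ _ c fE; rewrite eq_sym -efeq (negbTE nX); apply.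
  have Yf : e.2 \in Y'.
    by have := other _ _ _ _ c' eE nef; rewrite efeq (negbTE nX').
  have c1 : vertex_cover E (X :&: X') (Y :|: Y').
    apply/vertex_coverP=> p pE; rewrite !inE.
    have [->|npe] := eqVneq p e; first by rewrite Yf !orbT.
    have [->|npf] := eqVneq p f; first by rewrite Ye !orbT.
    move: (other _ _ _ _ c pE npe) (other _ _ _ _ c' pE npf).
    by do 4!case: (_ \in _).
  have c2 : vertex_cover E (e.1 |: (X :|: X')) (Y :&: Y').
    apply/vertex_coverP=> p pE; rewrite !inE.
    have [->|npe] := eqVneq p e; first by rewrite eqxx.
    have [->|npf] := eqVneq p f; first by rewrite efeq eqxx.
    move: (other _ _ _ _ c pE npe) (other _ _ _ _ c' pE npf).
    by case: eqP => //= _; do 4!case: (_ \in _).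
  (* The two covers have at most 2(n - 1) + 1 vertices in total, so one of them has fewer than
     [n]. *)
  move: (cov _ _ c1) (cov _ _ c2) (cardsUI X X') (cardsUI Y Y') lt lt'.
  by rewrite cardsU1; clear; case: (_ \notin _); lia.
- have [X [Y [c lt nX nY]]] := small e eE.
  have [X' [Y' [c' lt' nX' nY']]] := small f fE.
  have Xe : f.1 \in X.
    by have := other _ _ _ _ c fE; rewrite eq_sym -efeq (negbTE nY) orbF; apply.
  have Xf : e.1 \in X'.
    by have := other _ _ _ _ c' eE nef; rewrite efeq (negbTE nY') orbF.
  have c1 : vertex_cover E (X :|: X') (Y :&: Y').
    apply/vertex_coverP=> p pE; rewrite !inE.
    have [->|npe] := eqVneq p e; first by rewrite Xf !orbT.
    have [->|npf] := eqVneq p f; first by rewrite Xe.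
    move: (other _ _ _ _ c pE npe) (other _ _ _ _ c' pE npf).
    by do 4!case: (_ \in _).
  have c2 : vertex_cover E (X :&: X') (e.2 |: (Y :|: Y')).
    apply/vertex_coverP=> p pE; rewrite !inE.
    have [->|npe] := eqVneq p e; first by rewrite eqxx orbT.
    have [->|npf] := eqVneq p f; first by rewrite efeq eqxx orbT.
    move: (other _ _ _ _ c pE npe) (other _ _ _ _ c' pE npf).
    by case: eqP => //= _; do 4!case: (_ \in _).
  move: (cov _ _ c1) (cov _ _ c2) (cardsUI X X') (cardsUI Y Y') lt lt'.
  by rewrite cardsU1; clear; case: (_ \notin _); lia.
Qed.

Theorem konig E : exists M X Y,
  [/\ M \subset E, matching M, vertex_cover E X Y & #|X| + #|Y| <= #|M|].
Proof.
have cT : vertex_cover E setT setT by apply/vertex_coverP=> p _; rewrite inE.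
have ex : exists n, [exists X, exists Y, vertex_cover E X Y && (#|X| + #|Y| == n)].
  exists (#|[set: S]| + #|[set: T]|); apply/existsP; exists setT.
  by apply/existsP; exists setT; rewrite cT eqxx.
case: (ex_minnP ex) => n /existsP[X /existsP[Y /andP[cXY /eqP <-]]] minn.
have [|M [sM mM leM]] := @matching_of_covers (#|X| + #|Y|) E.
  move=> X' Y' c'; apply: minn; apply/existsP; exists X'; apply/existsP.
  by exists Y'; rewrite c' eqxx.
by exists M, X, Y.
Qed.

End Konig.

(** * Independent sets and 4-cycles in dense relations *)

Section DenseRelation.
Variables (I : finType) (e : rel I) (k : nat).
Implicit Types (Q X Y Z : {set I}).

Definition edges X Y := \sum_(x in X) \sum_(y in Y) (e x y : nat).

(** The diagonal is exempt: in the application, the edge from an index to itself is covered by the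
    chain graph attached to that index. *)
Definition independent Q := [forall x in Q, forall y in Q, (x != y) ==> ~~ e x y].

Lemma independentP Q :
  reflect {in Q &, forall x y, x != y -> ~~ e x y} (independent Q).
Proof.
apply: (iffP forall_inP) => [H x y xQ yQ|H x xQ].
  by move/forall_inP/(_ y yQ)/implyP: (H x xQ).
by apply/forall_inP=> y yQ; apply/implyP; apply: H.
Qed.

Lemma edgesC X Y : edges X Y = \sum_(y in Y) \sum_(x in X) (e x y : nat).
Proof. exact: exchange_big. Qed.

Lemma edgesS X X' Y Y' : X \subset X' -> Y \subset Y' -> edges X Y <= edges X' Y'.
Proof.
move=> sX sY; rewrite /edges [X in _ <= X](big_setID X) /= (setIidPr sX).
apply: leq_trans (leq_addr _ _); apply: leq_sum => x _.
rewrite [X in _ <= X](big_setID Y) /= (setIidPr sY); exact: leq_addr.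
Qed.

Lemma edges_splitl X Y Z : Y \subset X -> edges X Z = edges Y Z + edges (X :\: Y) Z.
Proof. by move=> sYX; rewrite /edges (big_setID Y) /= (setIidPr sYX). Qed.

Lemma edges_splitr X Y Z : Y \subset Z -> edges X Z = edges X Y + edges X (Z :\: Y).
Proof.
move=> sYZ; rewrite /edges -big_split /=; apply: eq_bigr => x _.
by rewrite (big_setID Y) /= (setIidPr sYZ).
Qed.

(* A Turan-type bound, obtained by repeatedly removing a maximal independent *)
(* set: each removed set meets an edge from every remaining vertex.          *)
Lemma turan Q : (forall Q', independent Q' -> #|Q'| <= k) ->
  #|Q| * #|Q| <= 2 * k * edges Q Q + 2 * k * #|Q|.
Proof.
move=> indk; have [n] := ubnP #|Q|; elim: n Q => // n IHn Q ltn.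
have [->|[x0 x0Q]] := set_0Vmem Q; first by rewrite cards0.
pose P Z := independent Z && (Z \subset Q).
have P0 : P [set x0].
  rewrite /P sub1set x0Q andbT; apply/independentP=> x y.
  by rewrite !inE => /eqP-> /eqP->; rewrite eqxx.
have [Z /maxsetP[/andP[indZ sZQ] maxZ] x0Z] := maxset_exists P0.
have Z0 : 0 < #|Z| by apply/card_gt0P; exists x0; rewrite -sub1set.
have Zk := indk _ indZ.
have cQ : #|Q| = #|Z| + #|Q :\: Z|.
  by rewrite -(cardsID Z Q) (setIidPr sZQ).
have := IHn (Q :\: Z); have -> : #|Q :\: Z| < n by lia.
move=> /(_ isT) IH.
have eQ : edges (Q :\: Z) (Q :\: Z) + #|Q :\: Z| <= edges Q Q.
  rewrite (edges_splitl Q sZQ) (edges_splitr _ sZQ).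
  rewrite (edges_splitr (Q :\: Z) sZQ).
  suff : #|Q :\: Z| <= edges Z (Q :\: Z) + edges (Q :\: Z) Z by lia.
  rewrite edgesC /edges -big_split -sum1_card /=; apply: leq_sum => x.
  rewrite inE => /andP[nxZ xQ]; rewrite lt0n -leqn0; apply/negP=> le0.
  have s0 (y : I) : y \in Z -> ~~ e y x /\ ~~ e x y.
    move=> yZ; move: le0; rewrite (bigD1 y) //= [X in _ + X](bigD1 y) //=.
    by case: (e y x); case: (e x y) => //=; lia.
  case/negP: nxZ; rewrite -(maxZ (x |: Z)) ?setU11 ?subsetU1 //.
  rewrite /P subUset sub1set xQ sZQ !andbT; apply/independentP=> y z.
  rewrite !inE => /orP[/eqP->|yZ] /orP[/eqP->|zZ]; rewrite ?eqxx // => nyz.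
  - by case: (s0 z zZ).
  - by case: (s0 y yZ).
  - by move/independentP: indZ; apply.
(* With z = [#|Z|] <= k and q remaining elements, the left side grows by 2zq + z^2, which is at most
   2kq + 2kz. *)
rewrite cQ; nia.
Qed.

(** Averaging: if every [y] failed, summing over [Q] would contradict [turan]. *)
Lemma popular_vertex Q : (forall Q', independent Q' -> #|Q'| <= k) ->
  0 < #|Q| -> exists2 y, y \in Q & #|Q| <= 2 * k * #|[set x in Q | e x y]| + 2 * k.
Proof.
move=> indk Q0; apply/exists_inP; apply: contraT.
rewrite negb_exists_in => /forall_inP small.
have := turan Q indk; rewrite edgesC big_distrr /=.
suff : \sum_(y in Q) 2 * k * (\sum_(x in Q) e x y) + \sum_(y in Q) 2 * k
       < \sum_(y in Q) #|Q|.
  rewrite !sum_nat_const; lia.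
rewrite -big_split /=; have [y0 y0Q] := card_gt0P Q0.
have lt y : y \in Q -> 2 * k * (\sum_(x in Q) e x y) + 2 * k < #|Q|.
  move=> /small; rewrite -ltnNge; congr (_ * _ + _ < _).
  by rewrite -sum1_card big_mkcond [RHS]big_mkcond; apply: eq_bigr => x _;
    rewrite !inE; case: (x \in Q); case: (e x y).
rewrite (bigD1 y0) //= [X in _ < X](bigD1 y0) //= -addSn.
apply: leq_add; first exact: lt.
by apply: leq_sum => y /andP[/lt/ltnW].
Qed.

(** Greedy: each new popular [b] claims [N] of its in-neighbours that have no owner yet. The edges
    from elements to their owners form the stock from which [F] is chosen in
    [saving_configuration]. *)
Lemma owners (N : nat) : (forall Q', independent Q' -> #|Q'| <= k) ->
    0 < k -> 0 < N -> 32 * k <= #|I| -> 8 * k * N <= #|I| ->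
  forall t, t <= 2 * k -> exists (B : {set I}) (ow : I -> option I),
    [/\ #|B| = t, forall a b, ow a = Some b -> b \in B /\ e a b
      & forall b, b \in B -> #|[set a | ow a == Some b]| = N].
Proof.
move=> indk k0 N0 kI NI; elim=> [_|t IHt lt].
  exists set0, (fun=> None); split; first by rewrite cards0.
  - by [].
  - by move=> b; rewrite inE.
have [B [ow [cB owB owN]]] := IHt (ltnW lt).
pose Q := [set a | ow a == None] :\: B.
have cQ : #|I| <= #|Q| + t * N + t.
  have -> : #|I| = #|[set a : I | ow a == None]| + #|[set a : I | ow a != None]|.
    rewrite -(cardC [set a : I | ow a == None]); congr (_ + _).
    by apply: eq_card => a; rewrite !inE.
  have -> : #|[set a : I | ow a != None]| = t * N.
    rewrite -cB -sum_nat_const -(eq_bigr _ owN) -sum1_card.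
    rewrite (partition_big (fun a => odflt a (ow a)) (mem B)) /=; last first.
      by move=> a; rewrite inE; case E: (ow a) => [b|] // _; case: (owB _ _ E).
    apply: eq_bigr => b bB; rewrite -sum1_card; apply: eq_bigl => a.
    by rewrite !inE; case E: (ow a) => [b'|] //=.
  have := cardsID B [set a : I | ow a == None]; rewrite -/Q.
  have := subset_leq_card (subsetIr [set a : I | ow a == None] B).
  by rewrite cB; lia.
have Q0 : 0 < #|Q| by nia.
have [y yQ leQ] := popular_vertex indk Q0.
(* Owned elements make up at most a quarter of [I] and [B] at most a sixteenth, so a popular vertex
   of [Q] still has [N] in-neighbours in [Q]. *)
have leN : N <= #|[set x in Q | e x y]| by nia.
have [Y sY cY] := exists_subset_card leN.
exists (y |: B), (fun a => if a \in Y then Some y else ow a).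
have yB : y \notin B by move: yQ; rewrite inE => /andP[].
have Yow a : a \in Y -> ow a = None /\ e a y.
  move/(subsetP sY); rewrite !inE => /andP[/andP[_ /eqP->]] ->.
  by [].
split; first by rewrite cardsU1 yB cB.
- move=> a b; case: ifP => [aY [<-]|_ /owB[bB ab]].
    by rewrite setU11; have [] := Yow a aY.
  by rewrite inE bB orbT.
move=> b; rewrite !inE => /orP[/eqP->|bB].
  rewrite -cY; apply: eq_card => a; rewrite !inE.
  case: ifP => [_|_]; first by rewrite eqxx.
  by apply/eqP=> /owB[]; rewrite (negbTE yB).
rewrite -(owN b bB); apply: eq_card => a; rewrite !inE.
case: ifP => // aY; have [-> _] := Yow a aY.
by apply/eqP=> -[yb]; move: yB; rewrite yb bB.
Qed.

(* The 4-cycle a, v, u, b lets a chain graph centred at u and v take care of *)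
(* the edge from a to b.  If a cannot be served, then almost all of its      *)
(* neighbours v are private to a within the neighbourhood of some b, which   *)
(* bounds the number of edges at such vertices a in [private_edges].         *)
Lemma serve_or_private (Sf Tf : {set I}) a (bs : seq I) :
  (exists R : seq (I * I),
     [/\ size R <= size bs, uniq (unzip1 R), uniq (unzip2 R),
         forall p, p \in R ->
           [/\ p.1 \in Sf, p.1 != a, p.2 \in Tf, e p.1 p.2 & e a p.2]
       & forall b, b \in bs -> e a b -> has (fun p => e p.1 b) R]) \/
  (exists b (Y : {set I}),
     [/\ b \in bs, #|Y| <= size bs, e a b
       & forall v, v \in Tf -> v \notin Y -> e a v ->
           forall u, u \in Sf -> u != a -> e u v -> ~~ e u b]).
Proof.
elim: bs => [|b bs IHbs]; first by left; exists [::].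
case: IHbs => [[R [sR u1 u2 RP RC]]|[b' [Y [b'bs cY ab' priv]]]]; last first.
  right; exists b', Y; split=> //; first by rewrite inE b'bs orbT.
  exact: leqW.
case: (boolP (e a b ==> has (fun p => e p.1 b) R)) => [/implyP Rb|].
  left; exists R; split=> //; first exact: leqW.
  by move=> b'; rewrite inE => /orP[/eqP->|/RC].
rewrite negb_imply => /andP[ab nRb].
case: (boolP [exists p : I * I, [&& p.1 \in Sf, p.1 != a, p.2 \in Tf, e p.1 p.2,
   e a p.2, p.1 \notin unzip1 R, p.2 \notin unzip2 R & e p.1 b]]).
  case/existsP=> -[u v] /= /and5P[uS ua vT uv /and4P[av uR vR ub]].
  left; exists ((u, v) :: R); split=> //=; rewrite ?uR ?vR //.
    by move=> p; rewrite inE => /orP[/eqP->|/RP].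
  move=> b'; rewrite inE => /orP[/eqP->|/RC H /H ->]; last by rewrite orbT.
  by rewrite ub.
move/existsPn=> nE; right; exists b, [set v in unzip2 R]; split=> //.
- by rewrite inE eqxx.
- by rewrite cardsE (leq_trans (card_size _)) // size_map ltnW.
move=> v vT; rewrite inE => vR av u uS ua uv; apply/negP=> ub.
move: (nE (u, v)); rewrite /= uS ua vT uv av vR ub /= andbT negbK.
(* A vertex [u] that is already used in [R] and adjacent to [b] would have taken care of [b]
   before. *)
case/mapP=> p pR up; case/negP: nRb; apply/hasP; exists p => //.
by rewrite -up.
Qed.

(** Double counting: at each [a] at most [t] edges end in the exceptional set, and every other edge
    to [v] is charged to a pair (b, v). Two elements of [X] charged to the same pair would violate
    each other's privacy. *)
Lemma private_edges (Sf Tf B X : {set I}) t : X \subset Sf ->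
  (forall a, a \in X -> exists b (Y : {set I}),
     [/\ b \in B, #|Y| <= t, e a b
       & forall v, v \in Tf -> v \notin Y -> e a v ->
           forall u, u \in Sf -> u != a -> e u v -> ~~ e u b]) ->
  edges X Tf <= t * #|X| + #|B| * #|Tf|.
Proof.
move=> sX privX.
pose priv a b v := [&& e a b, e a v & [forall u in Sf, (u != a) ==> e u v ==> ~~ e u b]].
apply: (@leq_trans (\sum_(a in X) (t + \sum_(b in B) \sum_(v in Tf) priv a b v))).
  apply: leq_sum => a aX; have [b [Y [bB cY ab abY]]] := privX a aX.
  rewrite [X in _ <= _ + X](bigD1 b) //= addnA; apply: leq_trans (leq_addr _ _).
  apply: (@leq_trans (\sum_(v in Tf) (v \in Y : nat) + \sum_(v in Tf) priv a b v)).
    rewrite -big_split; apply: leq_sum => v vT /=.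
    have [//|nvY] := boolP (v \in Y); first by case: (e a v).
    rewrite /priv ab; have [av|//] := boolP (e a v).
    suff -> : [forall u in Sf, (u != a) ==> e u v ==> ~~ e u b] by [].
    apply/forall_inP=> u uS; apply/implyP=> ua; apply/implyP=> uv.
    exact: abY uv.
  rewrite leq_add2r; apply: leq_trans cY; rewrite -sum1_card.
  rewrite big_mkcond [X in _ <= X]big_mkcond; apply: leq_sum => v _.
  by case: (v \in Y); case: (v \in Tf).
rewrite big_split /= sum_nat_const mulnC leq_add2l exchange_big /=.
rewrite -sum_nat_const; apply: leq_sum => b _.
rewrite exchange_big -sum1_card; apply: leq_sum => v vT /=.
rewrite leqNgt; apply/negP=> gt1.
have [a aX pa] : exists2 a, a \in X & priv a b v.
  apply/exists_inP; apply: contraLR gt1; rewrite negb_exists_in => /forall_inP n0.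
  by rewrite big1 // => a /n0/negbTE->.
have [a' /andP[a'X na'] pa'] : exists2 a', (a' \in X) && (a' != a) & priv a' b v.
  apply/exists_inP; apply: contraLR gt1; rewrite negb_exists_in => /forall_inP n0.
  by rewrite (bigD1 a) //= pa big1 // => a' /n0/negbTE->.
case/and3P: pa => ab av /forall_inP/(_ a' (subsetP sX _ a'X)).
by case/and3P: pa' => a'b a'v _; rewrite na' a'v a'b.
Qed.

(* A triple ((u, v), a) in R means that a is served by u and v. *)
Lemma saving_configuration : (forall Q', independent Q' -> #|Q'| <= k) ->
    0 < k -> 5000 * (k * k) <= #|I| ->
  exists (F : seq (I * I)) (R : seq (I * I * I)),
    [/\ size F = k, uniq (unzip1 F ++ [seq r.1.1 | r <- R]),
        uniq (unzip2 F ++ [seq r.1.2 | r <- R]),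
        all (fun p => e p.1 p.2) F &&
        all (fun r => e r.1.1 r.1.2 && e r.2 r.1.2) R
      & forall a b, a \in unzip1 F -> b \in unzip2 F -> e a b ->
          exists2 r, r \in R & r.2 = a /\ e r.1.1 b].
Proof.
move=> indk k0 bigI; pose N := #|I| %/ (8 * k).
have N1 : 8 * k * N <= #|I| by rewrite mulnC leq_divM.
have N2 : #|I| < 8 * k * N + 8 * k.
  by rewrite mulnC -mulSnr ltn_ceil //; lia.
have N0 : 0 < N by rewrite divn_gt0; nia.
have kI : 32 * k <= #|I| by nia.
have [B [ow [cB owB owN]]] := owners indk k0 N0 kI N1 (leqnn (2 * k)).
(* Induction on the number [j] of edges in [F]. Service is maintained towards all of [B], not only
   towards [unzip2 F], so that edges added later do not disturb it. *)
suff H j : j <= k -> exists (F : seq (I * I)) (R : seq (I * I * I)),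
    [/\ [/\ size F = j, size R <= j * (2 * k), uniq (unzip2 F) &
           uniq [seq r.1.2 | r <- R]],
        uniq (unzip1 F ++ [seq r.1.1 | r <- R]),
        forall p, p \in F -> ow p.1 = Some p.2,
        forall r, r \in R -> [/\ e r.1.1 r.1.2, e r.2 r.1.2 & r.1.2 \notin B]
      & forall a b, a \in unzip1 F -> b \in B -> e a b ->
          exists2 r, r \in R & r.2 = a /\ e r.1.1 b].
  have [F [R [[sF _ u2 uV] u1 FP RP serve]]] := H k (leqnn k).
  have F2 b : b \in unzip2 F -> b \in B.
    by case/mapP=> p /FP/owB[pB _] ->.
  exists F, R; split=> //; first 1 last.
  - apply/andP; split; apply/allP=> p; first by move=> /FP/owB[].
    by case/RP=> -> ->.
  - by move=> a b aF /F2; apply: serve.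
  rewrite cat_uniq u2 uV andbT /=; apply/hasPn=> v /mapP[r /RP[_ _ rB] ->].
  by apply: contra rB => /F2.
elim: j => [_|j IHj ltj]; first by exists [::], [::].
have [F [R [[sF sR u2 uV] u1 FP RP serve]]] := IHj (ltnW ltj).
pose Sf := [set s | s \notin unzip1 F ++ [seq r.1.1 | r <- R]].
pose Tf := ~: B :&: [set t | t \notin [seq r.1.2 | r <- R]].
pose X := [set a in Sf | if ow a is Some b then b \notin unzip2 F else false].
have sXS : X \subset Sf by apply/subsetP=> a; rewrite inE => /andP[].
pose served a := exists R : seq (I * I),
     [/\ size R <= size (enum B), uniq (unzip1 R), uniq (unzip2 R),
         forall p, p \in R ->
           [/\ p.1 \in Sf, p.1 != a, p.2 \in Tf, e p.1 p.2 & e a p.2]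
       & forall b, b \in enum B -> e a b -> has (fun p => e p.1 b) R].
have sB : size (enum B) = 2 * k by rewrite -cardE cB.
have [[a [aX [Ra [sRa uRa1 uRa2 RaP Rac]]]]|nserved] :
    (exists a, a \in X /\ served a) \/
    (forall a, a \in X -> exists b (Y : {set I}),
     [/\ b \in B, #|Y| <= 2 * k, e a b
       & forall v, v \in Tf -> v \notin Y -> e a v ->
           forall u, u \in Sf -> u != a -> e u v -> ~~ e u b]).
(* [served] is not boolean, so the dichotomy over [X] goes by induction on a list of its
   elements. *)
- have H (s : seq I) : {subset s <= X} -> (exists a, a \in X /\ served a) \/
    (forall a, a \in s -> exists b (Y : {set I}),
     [/\ b \in B, #|Y| <= 2 * k, e a b
       & forall v, v \in Tf -> v \notin Y -> e a v ->
           forall u, u \in Sf -> u != a -> e u v -> ~~ e u b]).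
    elim: s => [|a s IHs] sX; first by right.
    have [|sv|bad] := IHs; [by move=> x xs; apply: sX; rewrite inE xs orbT|by left|].
    have [sv|[b [Y [bB cY ab priv]]]] := serve_or_private Sf Tf a (enum B).
      by left; exists a; split=> //; apply: sX; rewrite inE eqxx.
    right=> x; rewrite inE => /orP[/eqP->|/bad //].
    by exists b, Y; rewrite -sB -mem_enum; split.
  have [|sv|bad] := H (enum X); [by move=> x; rewrite mem_enum|by left|right].
  by move=> a aX; apply: bad; rewrite mem_enum.
- move: aX; rewrite !inE => /andP[]; case owa : (ow a) => [b|//].
  move=> aSf nbF; exists ((a, b) :: F), ([seq (p, a) | p <- Ra] ++ R).
  split=> /=.
  + split; rewrite ?sF //; last first.
    * rewrite map_cat -map_comp (_ : map _ Ra = unzip2 Ra) //.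
      rewrite cat_uniq uRa2 uV andbT /=; apply/hasPn=> v vR.
      apply/mapP=> -[p /RaP[_ _ pT _ _] vp]; move: pT.
      by rewrite -vp !inE vR andbF.
    * by rewrite nbF.
    * by rewrite size_cat size_map mulSn leq_add // -sB.
  + rewrite map_cat -map_comp (_ : map _ Ra = unzip1 Ra) //.
    rewrite mem_cat mem_cat !negb_or.
    move: (aSf); rewrite mem_cat negb_or => /andP[-> ->]; rewrite andbT /=.
    apply/andP; split.
      by apply/mapP=> -[p /RaP[_ + _ _ _] ap]; rewrite -ap eqxx.
    rewrite uniq_catCA cat_uniq uRa1 u1 andbT /=; apply/hasPn=> u uFR.
    apply/mapP=> -[p /RaP[pS _ _ _ _] up]; move: pS.
    by rewrite inE -up uFR.
  + by move=> p; rewrite inE => /orP[/eqP->|/FP].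
  + move=> r; rewrite mem_cat => /orP[/mapP[p /RaP[_ _ pT pe ae] ->]|/RP //].
    by split=> //; move: pT; rewrite !inE => /andP[].
  + move=> a' b'; rewrite inE => /orP[/eqP-> b'B ab'|a'F b'B a'b'].
      rewrite -mem_enum in b'B; have /hasP[p pR pb'] := Rac b' b'B ab'.
      by exists (p, a); rewrite // mem_cat map_f.
    have [r rR [ra' rb']] := serve a' b' a'F b'B a'b'.
    by exists r; rewrite // mem_cat rR orbT.
(* No element of [X] can be served, so [X] sends few edges to [Tf]. But [Q] is still a constant
   fraction of [I], and [turan] forces many edges inside it. *)
have eX := private_edges sXS nserved.
pose Q := X :&: Tf.
have eQ : edges Q Q <= edges X Tf by rewrite edgesS ?subsetIl ?subsetIr.
have := turan Q indk.
have cB' : 2 * k - j <= #|B :\: [set b in unzip2 F]|.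
  have := cardsID [set b in unzip2 F] B; rewrite cB.
  have := subset_leq_card (subsetIr B [set b in unzip2 F]).
  have : #|[set b in unzip2 F]| <= j.
    by rewrite cardsE (leq_trans (card_size _)) // size_map sF.
  lia.
have cX : (2 * k - j) * N <= #|X| + j + size R.
  pose X' := [set a | if ow a is Some b then b \notin unzip2 F else false].
  apply: (@leq_trans #|X'|); last first.
    apply: (@leq_trans #|X :|: [set a in unzip1 F ++ [seq r.1.1 | r <- R]]|).
      apply: subset_leq_card; apply/subsetP=> a aX'; rewrite !inE.
      by move: aX'; rewrite !inE => ->; rewrite andbT orNb.
    rewrite -addnA; apply: leq_trans (leq_card_setU _ _) _.
    rewrite leq_add2l cardsE; apply: leq_trans (card_size _) _.
    by rewrite size_cat !size_map sF.
  apply: leq_trans (leq_mul cB' (leqnn _)) _.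
  have owN' b : b \in B :\: [set b in unzip2 F] ->
      N = \sum_(a in X' | ow a == Some b) 1.
    rewrite !inE => /andP[nb bB]; rewrite -(owN b bB) -sum1_card.
    apply: eq_bigl => a; rewrite !inE; case E: (ow a) => [b'|] //=.
    by rewrite andbC; case: eqP => //= -[->].
  rewrite -sum_nat_const (eq_bigr _ owN') -sum1_card.
  rewrite [X in _ <= X](partition_big (fun a => odflt a (ow a))
    (mem (B :\: [set b in unzip2 F]))) /=; last first.
    move=> a; rewrite !inE; case E: (ow a) => [b|] //= ->.
    by case: (owB _ _ E).
  apply: leq_sum => b _; rewrite leq_eqVlt; apply/orP; left; apply/eqP.
  by apply: eq_bigl => a; rewrite !inE; case E: (ow a) => [b'|].
have cQ : #|X| <= #|Q| + 2 * k + size R.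
  rewrite -(cardsID Tf X) -/Q -addnA leq_add2l.
  apply: (@leq_trans #|B :|: [set t in [seq r.1.2 | r <- R]]|).
    apply: subset_leq_card; apply/subsetP=> a; rewrite !inE => /andP[+ _].
    by rewrite negb_and !negbK.
  apply: leq_trans (leq_card_setU _ _) _.
  by rewrite cB leq_add2l cardsE (leq_trans (card_size _)) ?size_map.
have cXI := max_card (mem X); have cTI := max_card (mem Tf).
have cQI := max_card (mem Q).
move: (turan Q indk) eQ eX cX cQ sR ltj N2 bigI cXI cTI cQI k0; rewrite cB.
move: #|X| #|Tf| #|Q| (edges Q Q) (edges X Tf) (size R) #|I| => x t q e1 e2 r m.
clear=> H1 H2 H3 H4 H5 H6 H7 H8 H9 H10 H11 H12 k0.
have k2 : k <= k * k by rewrite leq_pmulr.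
have kN : k * N <= (2 * k - j) * N by rewrite leq_mul2r; apply/orP; right; lia.
have jk : j * (2 * k) <= k * (2 * k) by rewrite leq_mul2r (ltnW H7) orbT.
(* From here m^2 <= 256 q^2 <= 256(8 k^2 m + 2 k^2 m) = 2560 k^2 m, against m >= 5000 k^2. *)
have mq : m <= 16 * q by lia.
have xm : k * x <= k * m by rewrite leq_mul2l H10 orbT.
have tm : k * t <= k * m by rewrite leq_mul2l H11 orbT.
have e1m : k * e1 <= k * (4 * (k * m)) by rewrite leq_mul2l; apply/orP; right; lia.
have qm : k * q <= k * k * m by apply: leq_mul.
have mm : m * m <= 16 * q * (16 * q) by apply: leq_mul.
have km : 5000 * (k * k) * m <= m * m by rewrite leq_mul2r H9 orbT.
have km0 : 0 < k * k * m by rewrite !muln_gt0; lia.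
lia.
Qed.

End DenseRelation.

(** * Covering a bipartite graph by chain graphs *)

Lemma card_rest (V : finType) (s : seq V) (X : {set V}) :
    uniq s -> (forall x, x \in X -> x \notin s) ->
  #|[set x | x \notin s] :\: X| + #|X| + size s = #|V|.
Proof.
move=> us Xs; rewrite -(card_uniqP us) -(cardC (mem s)) [RHS]addnC.
congr (_ + _); have -> : #|[predC s]| = #|[set x | x \notin s]|.
  by apply: eq_card => x; rewrite !inE.
rewrite -(cardsID X [set x | x \notin s]) addnC; congr (#|pred_of_set _| + _).
by apply/setP=> x; rewrite !inE andbC; case: (boolP (x \in X)) => // /Xs ->.
Qed.

Section ChainCover.
Variables (S T : finType) (g : S -> T -> bool).
Implicit Types (h : (S -> nat) * (T -> nat)) (L : seq ((S -> nat) * (T -> nat))).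

(** Encodes a chain graph: the pairs with [h.2 t < h.1 s] have nested neighbourhoods, and the
    condition makes all of them edges of [g]. *)
Definition chain_level h := [forall s, forall t, ~~ g s t ==> (h.1 s <= h.2 t)].

Definition covered L s t := has (fun h => h.2 t < h.1 s) L.

Definition chain_cover_ge N := forall L, all chain_level L ->
  (forall s t, g s t -> covered L s t) -> N <= size L.

Lemma chain_levelP h :
  reflect (forall s t, ~~ g s t -> h.1 s <= h.2 t) (chain_level h).
Proof.
apply: (iffP forallP) => [H s t|H s].
  by move/forallP/(_ t)/implyP: (H s).
by apply/forallP=> t; apply/implyP; apply: H.
Qed.

Lemma covered_cat L L' s t : covered (L ++ L') s t = covered L s t || covered L' s t.
Proof. exact: has_cat. Qed.

Lemma covered_map (V : eqType) (f : V -> (S -> nat) * (T -> nat)) l p s t :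
  p \in l -> (f p).2 t < (f p).1 s -> covered (map f l) s t.
Proof. by move=> pl lt; rewrite /covered has_map; apply/hasP; exists p. Qed.

Definition lstar s0 : (S -> nat) * (T -> nat) :=
  (fun s => s == s0 : nat, fun t => ~~ g s0 t : nat).

Definition rstar t0 : (S -> nat) * (T -> nat) :=
  (fun s => g s t0 : nat, fun t => t != t0 : nat).

(* All edges at u and at v, and the edges joining a to common neighbours of *)
(* a and u.                                                                 *)
Definition tristar u v a : (S -> nat) * (T -> nat) :=
  (fun s => if s == u then 3 else if s == a then 2 else g s v,
   fun t => if t == v then 0 else if ~~ g u t then 3 else if ~~ g a t then 2 else 1).

Lemma lstar_level s0 : chain_level (lstar s0).
Proof. by apply/chain_levelP=> s t /=; case: eqP => //= ->; case: (g s0 t). Qed.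

Lemma rstar_level t0 : chain_level (rstar t0).
Proof.
apply/chain_levelP=> s t /=; case: eqP => [-> /negbTE-> //|_ _].
by case: (g s t0).
Qed.

Lemma tristar_level u v a : g u v -> g a v -> chain_level (tristar u v a).
Proof.
move=> uv av; apply/chain_levelP=> s t /=; case: eqP => [-> nut|_].
  by case: eqP nut => [->|_ ->]; rewrite ?uv.
case: eqP => [-> nat|_ nst]; last first.
  case: eqP nst => [-> /negbTE-> //|_ _]; case: (g s v) => //.
  by case: ifP => // _; case: ifP.
by case: eqP nat => [->|_ ->]; rewrite ?av //; case: ifP.
Qed.

Lemma lstar_covers s t : g s t -> (lstar s).2 t < (lstar s).1 s.
Proof. by move=> /= ->; rewrite eqxx. Qed.

Lemma rstar_covers s t : g s t -> (rstar t).2 t < (rstar t).1 s.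
Proof. by move=> /= ->; rewrite eqxx. Qed.

Lemma tristar_coversl u v a t : g u t -> (tristar u v a).2 t < (tristar u v a).1 u.
Proof. by move=> /= ->; rewrite eqxx; case: ifP => // _; case: ifP. Qed.

Lemma tristar_coversr u v a s : g s v -> (tristar u v a).2 v < (tristar u v a).1 s.
Proof. by move=> /= ->; rewrite eqxx; case: ifP => // _; case: ifP. Qed.

Lemma tristar_coversm u v a t : a != u -> g u t -> g a t ->
  (tristar u v a).2 t < (tristar u v a).1 a.
Proof. by move=> /negbTE nau /= -> ->; rewrite nau eqxx; case: ifP. Qed.

(* The first cover consists of the double stars of the matching M0 and a    *)
(* minimum vertex cover of the rest, the second one of L, the double stars  *)
(* of a maximum matching of the rest, and stars at what is left over.       *)
Lemma saving_bound N (M0 : seq (S * T)) L : chain_cover_ge N ->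
    all (fun p => g p.1 p.2) M0 -> uniq (unzip1 M0) -> uniq (unzip2 M0) ->
    all chain_level L ->
    (forall s t, s \in unzip1 M0 -> t \in unzip2 M0 -> g s t -> covered L s t) ->
  2 * N + size M0 <= #|S| + #|T| + size L.
Proof.
move=> hardN /allP gM0 u1 u2 vL covL.
pose E := [set p : S * T | [&& g p.1 p.2, p.1 \notin unzip1 M0 & p.2 \notin unzip2 M0]].
have [M [X [Y [sME [M1 M2] /vertex_coverP cXY leM]]]] := konig E.
have gM p : p \in M -> g p.1 p.2 /\ p.1 \notin unzip1 M0 /\ p.2 \notin unzip2 M0.
  by move/(subsetP sME); rewrite inE => /and3P[].
(* With [a = u] the middle level disappears and [tristar] is the union of the stars at two adjacent
   vertices. *)
pose dstar p := tristar p.1 p.2 p.1 : (S -> nat) * (T -> nat).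
have N1 : N <= size M0 + #|M|.
  pose L1 := map dstar M0 ++ map lstar (enum X) ++ map rstar (enum Y).
  apply: leq_trans (_ : size L1 <= _); last first.
    by rewrite !size_cat !size_map -!cardE leq_add2l.
  apply: hardN.
    rewrite !all_cat !all_map; apply/and3P; split; apply/allP=> p /=.
    - by move/gM0=> gp; apply: tristar_level.
    - by rewrite lstar_level.
    - by rewrite rstar_level.
  move=> s t gst; rewrite !covered_cat.
  have [/mapP[p pM sp]|sM] := boolP (s \in unzip1 M0).
    apply/orP; left; apply: (covered_map pM); rewrite sp.
    by apply: tristar_coversl; rewrite -sp.
  have [/mapP[p pM tp]|tM] := boolP (t \in unzip2 M0).
    apply/orP; left; apply: (covered_map pM); rewrite tp.
    by apply: tristar_coversr; rewrite -tp.
  apply/orP; right; apply/orP.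
  have /orP[/= sX|/= tY] : ((s, t).1 \in X) || ((s, t).2 \in Y).
  - by apply: cXY; rewrite inE gst sM tM.
  - by left; apply: (covered_map _ (lstar_covers gst)); rewrite mem_enum.
  - by right; apply: (covered_map _ (rstar_covers gst)); rewrite mem_enum.
pose S' := [set s | s \notin unzip1 M0] :\: [set p.1 | p in M].
pose T' := [set t | t \notin unzip2 M0] :\: [set p.2 | p in M].
have cS : #|S'| + #|M| + size M0 = #|S|.
  rewrite -(card_in_imset M1) -(size_map fst M0); apply: card_rest => // t.
  by case/imsetP=> p /gM[_ [? _]] ->.
have cT : #|T'| + #|M| + size M0 = #|T|.
  rewrite -(card_in_imset M2) -(size_map snd M0); apply: card_rest => // t.
  by case/imsetP=> p /gM[_ [_ ?]] ->.
have N2 : N <= size L + (#|M| + (#|S'| + #|T'|)).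
  pose L2 := L ++ map dstar (enum M) ++ map lstar (enum S') ++ map rstar (enum T').
  apply: leq_trans (_ : size L2 <= _); last by rewrite !size_cat !size_map -!cardE.
  apply: hardN.
    rewrite !all_cat vL !all_map andTb; apply/and3P; split; apply/allP=> p /=.
    - by rewrite mem_enum => /gM[gp _]; apply: tristar_level.
    - by rewrite lstar_level.
    - by rewrite rstar_level.
  move=> s t gst; rewrite !covered_cat.
  have [/imsetP[p pM sp]|sM] := boolP (s \in [set p.1 | p in M]).
    apply/orP; right; apply/orP; left; rewrite -mem_enum in pM.
    apply: (covered_map pM); rewrite sp.
    by apply: tristar_coversl; rewrite -sp.
  have [/imsetP[p pM tp]|tM] := boolP (t \in [set p.2 | p in M]).
    apply/orP; right; apply/orP; left; rewrite -mem_enum in pM.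
    apply: (covered_map pM); rewrite tp.
    by apply: tristar_coversr; rewrite -tp.
  have [sM0|sM0] := boolP (s \in unzip1 M0); last first.
    apply/or4P/Or43.
    by apply: (covered_map _ (lstar_covers gst)); rewrite mem_enum !inE sM sM0.
  have [tM0|tM0] := boolP (t \in unzip2 M0); last first.
    apply/or4P/Or44.
    by apply: (covered_map _ (rstar_covers gst)); rewrite mem_enum !inE tM tM0.
  by rewrite covL.
(* Adding [N1] and [N2], the term 2[#|M|] cancels against [cS] and [cT]. *)
clear -N1 N2 cS cT; lia.
Qed.

(** By the last hypothesis, any configuration in [saving_bound] with [size M0 >= size L + k] is
    contradictory. Otherwise at most 5000 k^2 disjoint pairs of matching edges spoil inducedness,
    and both edges of each pair are discarded. *)
Theorem induced_matching N k : chain_cover_ge N -> 0 < k ->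
    #|S| + #|T| < 2 * N + k ->
  exists s : seq (S * T),
    [/\ uniq s, {in s &, forall p q, g p.1 q.2 = (p == q)}
      & N <= size s + 2 * (5000 * (k * k))].
Proof.
move=> hardN k0 ltk.
have [M [X [Y [sME [M1 M2] /vertex_coverP cXY leM]]]] :=
  konig [set p : S * T | g p.1 p.2].
have gM p : p \in M -> g p.1 p.2 by move/(subsetP sME); rewrite inE.
have NM : N <= #|M|.
  pose L1 := map lstar (enum X) ++ map rstar (enum Y).
  apply: leq_trans (_ : size L1 <= _); last by rewrite !size_cat !size_map -!cardE.
  apply: hardN.
    rewrite !all_cat !all_map; apply/andP; split; apply/allP=> p /= _.
      exact: lstar_level.
    exact: rstar_level.
  move=> s t gst; rewrite covered_cat; apply/orP.
  have /orP[/= sX|/= tY] : ((s, t).1 \in X) || ((s, t).2 \in Y).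
  - by apply: cXY; rewrite inE.
  - by left; apply: (covered_map _ (lstar_covers gst)); rewrite mem_enum.
  - by right; apply: (covered_map _ (rstar_covers gst)); rewrite mem_enum.
(* A subset of [M] without arcs is an induced matching. *)
pose arc p q := [&& p \in M, q \in M, p != q & g p.1 q.2].
have [|s [/allP arcs us maxs]] := @maximal_matching _ arc.
  by move=> p; rewrite /arc eqxx !andbF.
have [small|big] := leqP (size s) (5000 * (k * k)).
  exists [seq p <- enum M | p \notin ends s]; split.
  - by rewrite filter_uniq ?enum_uniq.
  - move=> p q; rewrite [p \in _]mem_filter [q \in _]mem_filter !mem_enum.
    move=> /andP[ps pM] /andP[qs qM].
    have [<-|npq] := eqVneq p q; first exact: gM.
    apply: contraNF ps => gpq; have := maxs p q.
    by rewrite /arc pM qM npq gpq (negbTE qs) orbF; apply.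
  apply: leq_trans NM _; rewrite cardE -(count_predC (mem (ends s))).
  rewrite -!size_filter addnC leq_add2l.
  apply: (@leq_trans (size (ends s))); last by rewrite size_ends -mul2n leq_mul2l.
  apply: uniq_leq_size; first by rewrite filter_uniq ?enum_uniq.
  by move=> p; rewrite mem_filter => /andP[].
exfalso.
have [us1 us2 us12] : [/\ uniq (unzip1 s), uniq (unzip2 s)
    & forall p q, p \in s -> q \in s -> p.1 != q.2].
  move: us; rewrite cat_uniq => /and3P[-> /hasPn n12 ->]; split=> // p q ps qs.
  by apply: contraNneq (n12 q.2 (map_f _ qs)) => <-; apply: map_f.
have uniqs : uniq s by apply: map_uniq us1.
have inj1 p q : p \in s -> q \in s -> p.1 = q.1 -> p = q.
  move=> ps qs pq1; apply/eqP; rewrite -(nth_index p ps) -(nth_index p qs).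
  rewrite nth_uniq ?index_mem // -(nth_uniq p.1 _ _ us1) ?size_map ?index_mem //.
  by rewrite !(nth_map p) ?index_mem // !nth_index // pq1.
have inj2 p q : p \in s -> q \in s -> p.2 = q.2 -> p = q.
  move=> ps qs pq1; apply/eqP; rewrite -(nth_index p ps) -(nth_index p qs).
  rewrite nth_uniq ?index_mem // -(nth_uniq p.2 _ _ us2) ?size_map ?index_mem //.
  by rewrite !(nth_map p) ?index_mem // !nth_index // pq1.
pose I := seq_sub s.
(* An index [r] consists of the matching edges from [u r] to [y r] and from [x r] to [v r], linked
   by the edge from [u r] to [v r]. *)
pose x (r : I) := (ssval r).2.1; pose y (r : I) := (ssval r).1.2.
pose u (r : I) := (ssval r).1.1; pose v (r : I) := (ssval r).2.2.
have sP (r : I) : arc (ssval r).1 (ssval r).2 by apply: arcs; apply: ssvalP.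
have sM (r : I) : (ssval r).1 \in M /\ (ssval r).2 \in M.
  by case/and4P: (sP r).
have guv r : g (u r) (v r) by case/and4P: (sP r).
have gxv r : g (x r) (v r) by apply: gM; case: (sM r).
have guy r : g (u r) (y r) by apply: gM; case: (sM r).
have xinj : injective x.
  move=> r r' /M1 eq; apply/val_inj/inj2; rewrite ?ssvalP //.
  by apply: eq; [case: (sM r)|case: (sM r')].
have vinj : injective v.
  move=> r r' /M2 eq; apply/val_inj/inj2; rewrite ?ssvalP //.
  by apply: eq; [case: (sM r)|case: (sM r')].
have uinj : injective u.
  move=> r r' /M1 eq; apply/val_inj/inj1; rewrite ?ssvalP //.
  by apply: eq; [case: (sM r)|case: (sM r')].
have yinj : injective y.
  move=> r r' /M2 eq; apply/val_inj/inj1; rewrite ?ssvalP //.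
  by apply: eq; [case: (sM r)|case: (sM r')].
have xu r r' : x r != u r'.
  apply: contraNneq (us12 _ _ (ssvalP r') (ssvalP r)) => /M1 ->//.
    by case: (sM r).
  by case: (sM r').
have vy r r' : v r != y r'.
  apply: contraNneq (us12 _ _ (ssvalP r') (ssvalP r)) => /M2 ->//.
    by case: (sM r).
  by case: (sM r').
pose e r r' := g (x r) (y r').
have cI : #|{: I}| = size s by rewrite card_seq_sub.
have [/forallP indk|/forallPn[Q]] :=
    boolP [forall Q : {set I}, independent e Q ==> (#|Q| <= k)]; last first.
  rewrite negb_imply -ltnNge => /andP[/independentP indQ ltQ].
  (* Two edges per index against one chain graph: [tristar] also covers the edge from [x r] to
     [y r], and independence excludes edges from [x r] to [y r'] for different indices. More than
     [k] chain graphs are saved. *)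
  pose M0 := [seq (x r, v r) | r <- enum Q] ++ [seq (u r, y r) | r <- enum Q].
  pose L := [seq tristar (u r) (v r) (x r) | r <- enum Q].
  have M0E1 : unzip1 M0 = map x (enum Q) ++ map u (enum Q).
    by rewrite /unzip1 map_cat -!map_comp.
  have M0E2 : unzip2 M0 = map v (enum Q) ++ map y (enum Q).
    by rewrite /unzip2 map_cat -!map_comp.
  suff : 2 * N + size M0 <= #|S| + #|T| + size L.
    have arith (n m q : nat) : k < q -> m < 2 * n + k -> 2 * n + (q + q) <= m + q ->
      False by clear; lia.
    by rewrite /M0 /L size_cat !size_map -cardE => /(arith _ _ _ ltQ ltk).
  have disj (V : eqType) (f f' : I -> V) : injective f -> injective f' ->
      (forall r r', f r != f' r') -> uniq (map f (enum Q) ++ map f' (enum Q)).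
    move=> fi f'i ff'; rewrite cat_uniq !map_inj_uniq ?enum_uniq // andbT.
    by apply/hasPn=> _ /mapP[r _ ->]; apply/mapP=> -[r' _ /esym/eqP]; apply/negP.
  apply: saving_bound => //.
  - rewrite all_cat !all_map; apply/andP; split; apply/allP=> r _ //=.
  - by rewrite M0E1; apply: disj.
  - by rewrite M0E2; apply: disj.
  - by rewrite all_map; apply/allP=> r _; apply: tristar_level.
  move=> a b; rewrite M0E1 M0E2 !mem_cat => /orP[/mapP[r rQ ->]|/mapP[r rQ ->]].
    case/orP=> /mapP[r' r'Q ->] gab; last first.
      have [rr'|nrr'] := eqVneq r r'.
        apply: (covered_map rQ); rewrite -rr' in gab *.
        exact: tristar_coversm.
      rewrite mem_enum in rQ; rewrite mem_enum in r'Q.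
      by have /negP[] := indQ r r' rQ r'Q nrr'.
    by apply: (covered_map r'Q); apply: tristar_coversr.
  by move=> _ gab; apply: (covered_map rQ); apply: tristar_coversl.
have [|F [R [sF u1 u2 /andP[/allP eF /allP eR] serve]]] :=
  saving_configuration (e := e) (fun Q => implyP (indk Q)) k0.
  by rewrite cI ltnW.
(* Only the pairs in [R] receive a chain graph; the [k] edges of [F] are the saving. *)
pose M0 := [seq (x p.1, y p.2) | p <- F] ++ [seq (x r.1.1, y r.1.2) | r <- R].
pose L := [seq tristar (x r.1.1) (y r.1.2) (x r.2) | r <- R].
have M0E1 : unzip1 M0 = map x (unzip1 F ++ [seq r.1.1 | r <- R]).
  by rewrite /unzip1 !map_cat -!map_comp.
have M0E2 : unzip2 M0 = map y (unzip2 F ++ [seq r.1.2 | r <- R]).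
  by rewrite /unzip2 !map_cat -!map_comp.
suff : 2 * N + size M0 <= #|S| + #|T| + size L.
  have arith (n m r : nat) : m < 2 * n + k -> 2 * n + (k + r) <= m + r -> False.
    by clear; lia.
  by rewrite /M0 /L size_cat !size_map sF => /(arith _ _ _ ltk).
apply: saving_bound => //.
- rewrite all_cat !all_map; apply/andP; split; apply/allP=> r /=.
    by move/eF.
  by case/eR/andP.
- by rewrite M0E1 map_inj_uniq.
- by rewrite M0E2 map_inj_uniq.
- by rewrite all_map; apply/allP=> r /eR/andP[]; apply: tristar_level.
move=> a b; rewrite M0E1 M0E2 => /mapP[r rF ->] /mapP[r' r'F ->] grr'.
move: rF r'F; rewrite !mem_cat => /orP[rF|/mapP[q qR rq]]; last first.
  move=> _; apply: (covered_map qR); rewrite rq; apply: tristar_coversl.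
  by rewrite -rq.
move=> /orP[r'F|/mapP[q qR rq]]; last first.
  apply: (covered_map qR); rewrite rq; apply: tristar_coversr.
  by rewrite -rq.
have [q qR [qr qr']] := serve r r' rF r'F grr'.
apply: (covered_map qR); rewrite qr; apply: tristar_coversm => //.
rewrite (inj_eq xinj); move: u1; rewrite cat_uniq => /and3P[_ /hasPn nF _].
by apply: contraNneq (nF q.1.1 (map_f _ qR)) => <-.
Qed.

End ChainCover.

(** * Level maps and antichains *)

Section Levels.
Variables (T : finType) (le : rel T).
Hypotheses (lexx : reflexive le) (le_anti : antisymmetric le) (le_tr : transitive le).
Implicit Types (h : T -> nat) (H : seq (T -> nat)) (x y z w a : T).

(* A weakly monotone map to nat stands for the linear extensions refining it. *)
Definition level h := [forall x, forall y, le x y ==> (h x <= h y)].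

Definition inc x y := ~~ le x y && ~~ le y x.

Definition reverses H x y := has (fun h => h y < h x) H.

Definition dim_ge n := forall H, all level H ->
  (forall x y, inc x y -> reverses H x y) -> n <= size H.

Definition fully_up H x := forall y, ~~ le x y -> reverses H x y.

Definition fully_down H x := forall y, ~~ le y x -> reverses H y x.

Lemma levelP h : reflect (forall x y, le x y -> h x <= h y) (level h).
Proof.
apply: (iffP forallP) => [L x y|L x].
  by move/forallP/(_ y)/implyP: (L x).
by apply/forallP=> y; apply/implyP; apply: L.
Qed.

Lemma inc_sym x y : inc x y = inc y x.
Proof. by rewrite /inc andbC. Qed.

Lemma incW x y : inc x y -> ~~ le x y.
Proof. by case/andP. Qed.

Lemma reverses_cat H H' x y :
  reverses (H ++ H') x y = reverses H x y || reverses H' x y.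
Proof. exact: has_cat. Qed.

Lemma reverses_map (V : eqType) (f : V -> T -> nat) l p x y :
  p \in l -> f p y < f p x -> reverses (map f l) x y.
Proof. by move=> pl lt; rewrite /reverses has_map; apply/hasP; exists p. Qed.

Lemma fully_up_map (V : eqType) (f : V -> T -> nat) l p x :
  p \in l -> fully_up [:: f p] x -> fully_up (map f l) x.
Proof.
move=> pl fu y /fu; rewrite /reverses /= orbF; exact: reverses_map.
Qed.

Lemma fully_down_map (V : eqType) (f : V -> T -> nat) l p x :
  p \in l -> fully_down [:: f p] x -> fully_down (map f l) x.
Proof.
move=> pl fd y /fd; rewrite /reverses /= orbF; exact: reverses_map.
Qed.

Lemma fully_upl H H' x : fully_up H x -> fully_up (H ++ H') x.
Proof. by move=> fu y /fu; rewrite reverses_cat => ->. Qed.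

Lemma fully_upr H H' x : fully_up H' x -> fully_up (H ++ H') x.
Proof. by move=> fu y /fu; rewrite reverses_cat => ->; rewrite orbT. Qed.

Lemma fully_downl H H' x : fully_down H x -> fully_down (H ++ H') x.
Proof. by move=> fd y /fd; rewrite reverses_cat => ->. Qed.

Lemma fully_downr H H' x : fully_down H' x -> fully_down (H ++ H') x.
Proof. by move=> fd y /fd; rewrite reverses_cat => ->; rewrite orbT. Qed.

(* For a2 <= w: pushes w and a2 down, and a1 up if a1 is not below w. *)
Definition lower w a1 a2 : T -> nat :=
  fun z => if le z a2 then 0 else if le z w then 1 else if le a1 z then 3 else 2.

(** The order dual of [lower]: for w <= a2 it lifts [w] and [a2], and pushes [a1] down if [w] is not
    below [a1]. *)
Definition raise w a1 a2 : T -> nat :=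
  fun z => if le a2 z then 3 else if le w z then 2 else if le z a1 then 0 else 1.

Lemma lower_level w a1 a2 : level (lower w a1 a2).
Proof.
apply/levelP=> x y xy; rewrite /lower.
have [ya2|_] := boolP (le y a2); first by rewrite (le_tr xy ya2).
have [yw|_] := boolP (le y w); first by rewrite (le_tr xy yw); case: ifP.
have [a1x|_] := boolP (le a1 x); first by rewrite (le_tr a1x xy); do 2?case: ifP.
by do 2?case: ifP => //; case: ifP.
Qed.

Lemma raise_level w a1 a2 : level (raise w a1 a2).
Proof.
apply/levelP=> x y xy; rewrite /raise.
have [a2x|_] := boolP (le a2 x); first by rewrite (le_tr a2x xy).
have [wx|_] := boolP (le w x); first by rewrite (le_tr wx xy); case: ifP.
have [ya1|_] := boolP (le y a1); first by rewrite (le_tr xy ya1); do 2?case: ifP.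
by case: (le x a1); case: (le a2 y); case: (le w y).
Qed.

Lemma lower_down w a1 a2 : le a2 w -> fully_down [:: lower w a1 a2] w.
Proof.
move=> a2w y nyw; rewrite /reverses /= orbF /lower lexx (negbTE nyw).
have -> : le y a2 = false by apply: contraNF nyw => ya2; apply: le_tr ya2 a2w.
by do 2!case: ifP.
Qed.

Lemma lower_down2 w a1 a2 : fully_down [:: lower w a1 a2] a2.
Proof.
move=> y nya2; rewrite /reverses /= orbF /lower lexx (negbTE nya2).
by do 2?case: ifP.
Qed.

Lemma lower_up w a1 a2 : le a2 w -> ~~ le a1 w -> fully_up [:: lower w a1 a2] a1.
Proof.
move=> a2w na1w y na1y; rewrite /reverses /= orbF /lower lexx.
rewrite (negbTE na1w) (negbTE na1y).
have -> : le a1 a2 = false by apply: contraNF na1w => h; apply: le_tr h a2w.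
by do 2?case: ifP.
Qed.

Lemma raise_up w a1 a2 : le w a2 -> fully_up [:: raise w a1 a2] w.
Proof.
move=> wa2 y nwy; rewrite /reverses /= orbF /raise lexx (negbTE nwy).
have -> : le a2 y = false by apply: contraNF nwy => a2y; apply: le_tr wa2 a2y.
by do 2!case: ifP.
Qed.

Lemma raise_up2 w a1 a2 : fully_up [:: raise w a1 a2] a2.
Proof.
move=> y nya2; rewrite /reverses /= orbF /raise lexx (negbTE nya2).
by do 2?case: ifP.
Qed.

Lemma raise_down w a1 a2 : le w a2 -> ~~ le w a1 -> fully_down [:: raise w a1 a2] a1.
Proof.
move=> wa2 nwa1 y nya1; rewrite /reverses /= orbF /raise lexx.
rewrite (negbTE nwa1) (negbTE nya1).
have -> : le a2 a1 = false by apply: contraNF nwa1 => h; apply: le_tr wa2 h.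
by do 2?case: ifP.
Qed.

(** * Points above and below a maximal antichain *)

Section Antichain.
Variable A : {set T}.
Hypothesis antiA : {in A &, forall x y, le x y -> x = y}.
Hypothesis maxA : forall x, x \notin A -> exists2 a, a \in A & le a x || le x a.

Definition above := [set x | (x \notin A) && [exists a in A, le a x]].
Definition below := [set x | (x \notin A) && [exists a in A, le x a]].

Lemma aboveP x : x \in above -> x \notin A /\ exists2 a, a \in A & le a x.
Proof. by rewrite inE => /andP[xA /exists_inP[a aA ax]]; split=> //; exists a. Qed.

Lemma belowP x : x \in below -> x \notin A /\ exists2 a, a \in A & le x a.
Proof. by rewrite inE => /andP[xA /exists_inP[a aA ax]]; split=> //; exists a. Qed.

Lemma above_nle u a : u \in above -> a \in A -> ~~ le u a.
Proof.
case/aboveP=> uA [a' a'A a'u] aA; apply: contraNN uA => ua.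
have aa' := antiA a'A aA (le_tr a'u ua); subst a'.
by have -> : u = a by apply/le_anti; rewrite ua a'u.
Qed.

Lemma below_nle d a : d \in below -> a \in A -> ~~ le a d.
Proof.
case/belowP=> dA [a' a'A da'] aA; apply: contraNN dA => ad.
have aa' := antiA aA a'A (le_tr ad da'); subst a'.
by have -> : d = a by apply/le_anti; rewrite ad da'.
Qed.

Lemma above_below_nle u d : u \in above -> d \in below -> ~~ le u d.
Proof.
move=> uU /belowP[_ [a aA da]]; apply: contraNN (above_nle uU aA) => ud.
exact: le_tr ud da.
Qed.

Lemma above_nbelow u : u \in above -> u \notin below.
Proof.
by move=> uU; apply/negP=> uD; have := above_below_nle uU uD; rewrite lexx.
Qed.

Lemma below_down d x : d \in below -> le x d -> x \in below.
Proof.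
move=> dD xd; have [_ [a aA da]] := belowP dD; rewrite inE.
apply/andP; split; last by apply/exists_inP; exists a => //; apply: le_tr xd da.
by apply: contraTN xd => xA; apply: below_nle.
Qed.

Lemma antichain_cases x : [\/ x \in A, x \in above | x \in below].
Proof.
have [xA|xA] := boolP (x \in A); first by constructor 1.
have [a aA /orP[ax|xa]] := maxA xA; [constructor 2|constructor 3];
  by rewrite inE xA; apply/exists_inP; exists a.
Qed.

Lemma card_above_below : #|above| + #|below| + #|A| = #|T|.
Proof.
rewrite -(cardsC A) [RHS]addnC; congr (_ + _).
rewrite -(cardsID above (~: A)); congr (_ + _); apply: eq_card => x.
  by rewrite !inE; case: (x \in A).
rewrite in_setD in_setC; apply/idP/andP => [xD|[xU xA]].
  split; last by case/belowP: xD.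
  by apply/negP=> /above_nbelow; rewrite xD.
by have [xA'|xU'|] := antichain_cases x; rewrite // ?xA' ?xU' in xA xU *.
Qed.

(** The two maps list [A] in opposite orders, with [below] under it and [above] over it. The ranks
    in [layers1] start at 1 to keep [A] strictly over [below]. *)
Definition layers1 : T -> nat := fun z =>
  if z \in below then 0 else if z \in A then (enum_rank z).+1 else #|T|.+1.
Definition layers2 : T -> nat := fun z =>
  if z \in below then 0 else if z \in A then #|T| - enum_rank z else #|T|.+1.

Lemma layers_level (f : T -> nat) : (forall z, f z <= #|T|) ->
  level (fun z => if z \in below then 0 else if z \in A then f z else #|T|.+1).
Proof.
move=> fT; apply/levelP=> x y xy.
have [yD|_] := boolP (y \in below); first by rewrite (below_down yD xy).
have [yA|_] := boolP (y \in A); last first.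
  by case: ifP => // _; case: ifP => // _; rewrite ltnW ?ltnS.
have [xA|xU|->] := antichain_cases x => //.
  by rewrite (antiA xA yA xy) yA; case: ifP.
by move: xy; rewrite (negbTE (above_nle xU yA)).
Qed.

Lemma dim_le_rest n H : dim_ge n -> all level H ->
    (forall u y, u \in above -> inc y u -> reverses H y u) ->
    (forall d y, d \in below -> inc d y -> reverses H d y) ->
  n <= (size H).+2.
Proof.
move=> dim lH HU HD; apply: (dim [:: layers1, layers2 & H]) => [|x y xy].
  rewrite /= lH andbT; apply/andP; split; apply: layers_level => z.
    by rewrite ltn_ord.
  exact: leq_subr.
rewrite /reverses /= -/(reverses H x y).
have AD z : z \in A -> z \in below = false.
  by move=> zA; rewrite inE zA.
have UA z : z \in above -> z \in A = false.
  by rewrite inE => /andP[/negbTE].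
have [yA|yU|yD] := antichain_cases y; last first.
- have [xA|xU|xD] := antichain_cases x; last by rewrite HD ?orbT.
    by rewrite /layers1 yD (AD x xA) xA.
  by rewrite /layers1 yD (UA x xU) (negbTE (above_nbelow xU)).
- by rewrite HU ?orbT.
have [xA|xU|xD] := antichain_cases x; last by rewrite HD ?orbT.
  rewrite /layers1 /layers2 !AD // xA yA !ltnS.
  have : enum_rank x != enum_rank y :> nat.
    apply: contraTneq xy => /ord_inj/enum_rank_inj->.
    by rewrite /inc lexx.
  rewrite neq_ltn => /orP[lt|->] //.
  by rewrite [X in _ || (X || _)](ltn_sub2l _ lt) ?orbT // ltn_ord.
rewrite /layers1 (UA x xU) (negbTE (above_nbelow xU)) AD // yA ltnS.
by rewrite ltn_ord.
Qed.

(** Deleting an element costs two level maps, one placing it as low and one as high as possible;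
    together they settle every pair that involves it. *)
Lemma dim_le_del n (X : {set T}) H : dim_ge n -> all level H ->
    (forall u y, u \in above :\: X -> y \notin X -> inc y u -> reverses H y u) ->
    (forall d y, d \in below :\: X -> y \notin X -> inc d y -> reverses H d y) ->
  n <= size H + 2 * #|X| + 2.
Proof.
move=> dim lH HU HD.
pose H' := [seq lower x x x | x <- enum X] ++ [seq raise x x x | x <- enum X] ++ H.
have lH' : all level H'.
  rewrite !all_cat !all_map lH andbT; apply/andP; split; apply/allP=> x _ /=.
    exact: lower_level.
  exact: raise_level.
have Xd x : x \in X -> fully_down H' x.
  rewrite -mem_enum => xX; apply: fully_downl; apply: (fully_down_map xX).
  exact: lower_down.
have Xu x : x \in X -> fully_up H' x.
  rewrite -mem_enum => xX; apply/fully_upr/fully_upl; apply: (fully_up_map xX).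
  exact: raise_up.
suff : n <= (size H').+2 by rewrite /H' !size_cat !size_map -cardE; clear; lia.
apply: dim_le_rest => // [u y uU yu|d y dD dy].
  have [uX|uX] := boolP (u \in X); first by apply: Xd uX _ (incW yu).
  have [yX|yX] := boolP (y \in X); first by apply: Xu yX _ (incW yu).
  by rewrite /H' !reverses_cat HU ?orbT // inE uX.
have [dX|dX] := boolP (d \in X); first by apply: Xu dX _ (incW dy).
have [yX|yX] := boolP (y \in X); first by apply: Xd yX _ (incW dy).
by rewrite /H' !reverses_cat HD ?orbT // inE dX.
Qed.

(** What [dim_le_rest] still demands of a point outside [A]: to be low if it lies above [A], and
    high if below. *)
Definition role_full H w :=
  (w \in above -> fully_down H w) /\ (w \in below -> fully_up H w).

Definition role w := if w \in above then lower w w w else raise w w w.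

Lemma role_level w : level (role w).
Proof. by rewrite /role; case: ifP => _; [apply: lower_level|apply: raise_level]. Qed.

Lemma role_fullP l w : w \in l -> role_full (map role l) w.
Proof.
move=> wl; split=> [wU|wD].
  apply: (fully_down_map wl); rewrite /role wU; exact: lower_down.
apply: (fully_up_map wl); rewrite /role ifN; first exact: raise_up.
by apply/negP=> /above_nbelow; rewrite wD.
Qed.

Lemma role_fulll H H' w : role_full H w -> role_full (H ++ H') w.
Proof. by case=> d u; split=> [/d|/u]; [apply: fully_downl|apply: fully_upl]. Qed.

Lemma role_fullr H H' w : role_full H' w -> role_full (H ++ H') w.
Proof. by case=> d u; split=> [/d|/u]; [apply: fully_downr|apply: fully_upr]. Qed.

Lemma role_full_rev_above H u y : role_full H u -> u \in above -> inc y u ->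
  reverses H y u.
Proof. by case=> fd _ /fd{}fd /incW /fd. Qed.

Lemma role_full_rev_below H d y : role_full H d -> d \in below -> inc d y ->
  reverses H d y.
Proof. by case=> _ fu /fu{}fu /incW /fu. Qed.

Lemma above_nA u : u \in above -> u \notin A.
Proof. by case/aboveP. Qed.

Lemma below_nA d : d \in below -> d \notin A.
Proof. by case/belowP. Qed.

(** One map per point outside [A] suffices, and each pair sharing a map saves one. For empty [s] and
    [X] this reads [n <= #|~: A| + 2]. *)
Lemma pairs_saving n (X : {set T}) (s : seq (T * T)) (f : T * T -> T -> nat) :
    dim_ge n -> uniq (ends s) -> {subset ends s <= ~: A :\: X} ->
    (forall p, p \in s -> [/\ level (f p), role_full [:: f p] p.1
                            & role_full [:: f p] p.2]) ->
  n + size s <= #|~: A :\: X| + 2 * #|X| + 2.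
Proof.
move=> dim us sA fP; pose V := [set x in ends s].
pose H := map f s ++ map role (enum ((~: A :\: X) :\: V)).
have cV : #|V| = 2 * size s.
  by rewrite cardsE (card_uniqP us) size_ends mul2n.
have cW : #|~: A :\: X| = #|(~: A :\: X) :\: V| + 2 * size s.
  rewrite -(cardsID V (~: A :\: X)) addnC -cV; congr (_ + #|pred_of_set _|).
  by apply/setIidPr/subsetP=> x; rewrite inE => /sA.
suff : n <= size H + 2 * #|X| + 2.
  by rewrite cW /H size_cat !size_map -cardE; clear; lia.
have full w : w \notin A -> w \notin X -> role_full H w.
  move=> wA wX; have [wV|wV] := boolP (w \in ends s); last first.
    apply/role_fullr/role_fullP; rewrite mem_enum !inE wV wA wX.
    by [].
  apply: role_fulll; move: wV; rewrite mem_cat => /orP[]/mapP[p ps ->].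
    have [_ [d u] _] := fP p ps; split=> [/d|/u].
      exact: fully_down_map.
    exact: fully_up_map.
  have [_ _ [d u]] := fP p ps; split=> [/d|/u].
    exact: fully_down_map.
  exact: fully_up_map.
apply: dim_le_del => //.
- rewrite all_cat !all_map; apply/andP; split; apply/allP=> p.
    by case/fP.
  by move=> _; apply: role_level.
- move=> u y; rewrite in_setD => /andP[uX uU] _; apply: role_full_rev_above => //.
  by apply: full; rewrite ?above_nA.
move=> d y; rewrite in_setD => /andP[dX dD] _; apply: role_full_rev_below => //.
by apply: full; rewrite ?below_nA.
Qed.

(* One level map serving u (pushed down) and d (pushed up) at once, where   *)
(* only the elements of Up are lifted above u and the others go below d.    *)
Definition merged (Up : {set T}) u d : T -> nat := fun z =>
  if le d z then if le z u then 2 else 3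
  else if [exists a in Up, ~~ le a u && le a z] then 3 else 1.

Lemma merged_level Up u d : level (merged Up u d).
Proof.
apply/levelP=> x y xy; rewrite /merged.
have [dx|_] := boolP (le d x).
  rewrite (le_tr dx xy); have [yu|_] := boolP (le y u); last by case: ifP.
  by rewrite (le_tr xy yu).
case: ifP => [/exists_inP[a aU /andP[au ax]]|_]; last by do 2!case: ifP.
case: ifP => [_|_].
  by rewrite ifN //; apply: contra au => yu; apply: le_tr (le_tr ax xy) yu.
rewrite ifT //; apply/exists_inP; exists a => //.
by rewrite au (le_tr ax xy).
Qed.

(** In a map shared by [u] and [d], an element of [A] incomparable to both would have to be over [u]
    and under [d]. Hence the last hypothesis: [H0] already meets its demands against all of [cu] or
    all of [cd]. *)
Lemma merge_saving n (X : {set T}) cu cd H0 : dim_ge n -> size cu = size cd ->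
    {subset cu <= above :\: X} -> {subset cd <= below :\: X} ->
    (forall u d, u \in above :\: X -> d \in below :\: X -> le d u) ->
    all level H0 ->
    (forall w, w \notin A -> w \notin X -> w \notin cu -> w \notin cd ->
       role_full H0 w) ->
    (forall a, a \in A -> (forall u, u \in cu -> inc a u -> reverses H0 a u) \/
                          (forall d, d \in cd -> inc d a -> reverses H0 d a)) ->
  n <= size H0 + size cu + 2 * #|X| + 2.
Proof.
move=> dim size_cud cuU cdD dltu lH0 full0 hosted.
pose Up := [set a in A | ~~ all (fun u => inc a u ==> reverses H0 a u) cu].
pose H1 := [seq merged Up p.1 p.2 | p <- zip cu cd].
suff : n <= size (H0 ++ H1) + 2 * #|X| + 2.
  by rewrite size_cat size_map size_zip -size_cud minnn.
have partner_u u : u \in cu -> exists2 d, (u, d) \in zip cu cd & d \in cd.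
  rewrite -{1}(unzip1_zip (s := cu) (t := cd)) ?size_cud //.
  case/mapP=> -[u' d] zp /= ->; exists d => //.
  by rewrite -(unzip2_zip (s := cu) (t := cd)) ?size_cud // (map_f snd zp).
have partner_d d : d \in cd -> exists2 u, (u, d) \in zip cu cd & u \in cu.
  rewrite -{1}(unzip2_zip (s := cu) (t := cd)) ?size_cud //.
  case/mapP=> -[u d'] zp /= ->; exists u => //.
  by rewrite -(unzip1_zip (s := cu) (t := cd)) ?size_cud // (map_f fst zp).
apply: dim_le_del => //.
- rewrite all_cat lH0 all_map; apply/allP=> p _; exact: merged_level.
- move=> u y uUX yX yu; have /setDP[uU uX] := uUX; rewrite reverses_cat.
  have [ucu|ucu] := boolP (u \in cu); last first.
    rewrite (role_full_rev_above _ uU yu) //; apply: full0 => //.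
      exact: above_nA.
    by apply/negP=> /cdD/setDP[uD _]; case/negP: (above_nbelow uU).
  have [d zp dcd] := partner_u u ucu; have dDX := cdD d dcd.
  have du := dltu u d uUX dDX.
  have mu : merged Up u d u = 2 by rewrite /merged du lexx.
  have [yA|yU|yD] := antichain_cases y.
  + have [yup|ydn] := boolP (y \in Up); last first.
      move: ydn; rewrite inE yA negbK => /allP/(_ u ucu)/implyP/(_ yu) ->.
      by [].
    apply/orP; right; apply: (reverses_map zp) => /=; rewrite mu /merged.
    rewrite (negbTE (incW yu)); case: ifP => // _; rewrite ifT //.
    by apply/exists_inP; exists y; rewrite ?lexx ?(incW yu).
  + apply/orP; right; apply: (reverses_map zp) => /=; rewrite mu /merged.
    by rewrite (negbTE (incW yu)) dltu // inE yX yU.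
  + by move: yu; rewrite /inc (dltu u y) // inE yX yD.
move=> d y dDX yX dy; have /setDP[dD dX] := dDX; rewrite reverses_cat.
have [dcd|dcd] := boolP (d \in cd); last first.
  rewrite (role_full_rev_below _ dD dy) //; apply: full0 => //.
    exact: below_nA.
  by apply/negP=> /cuU/setDP[dU _]; case/negP: (above_nbelow dU).
have [u zp ucu] := partner_d d dcd; have uUX := cuU u ucu.
have du := dltu u d uUX dDX.
have md : merged Up u d d = 2 by rewrite /merged lexx du.
have ndy := negbTE (incW dy).
have [yA|yU|yD] := antichain_cases y.
- have [yup|ydn] := boolP (y \in Up).
    have [yu|/(_ d dcd dy) -> //] := hosted y yA.
    move: yup; rewrite inE yA /= => /negP[]; apply/allP=> u' u'c.
    by apply/implyP; apply: yu.
  apply/orP; right; apply: (reverses_map zp) => /=; rewrite md /merged ndy ifN //.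
  apply/exists_inPn=> a aUp; apply/negP=> /andP[_ ay].
  have aA : a \in A by move: aUp; rewrite inE => /andP[].
  by move: aUp; rewrite (antiA aA yA ay) (negbTE ydn).
- by move: dy; rewrite /inc dltu // inE yX yU.
- apply/orP; right; apply: (reverses_map zp) => /=; rewrite md /merged ndy ifN //.
  apply/exists_inPn=> a; rewrite inE => /andP[aA _].
  by rewrite (negbTE (below_nle yD aA)) andbF.
Qed.

Lemma nA_cases w : w \notin A -> w \in above \/ w \in below.
Proof. by have [->|wU|wD] := antichain_cases w; [|left|right]. Qed.

(** Up settles [a] against every [u], down against every [d]; either meets the last hypothesis of
    [merge_saving]. *)
Definition hosts H a := fully_up H a \/ fully_down H a.

Lemma hostsl H H' a : hosts H a -> hosts (H ++ H') a.
Proof. by case; [left; apply: fully_upl|right; apply: fully_downl]. Qed.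

Lemma hostsr H H' a : hosts H' a -> hosts (H ++ H') a.
Proof. by case; [left; apply: fully_upr|right; apply: fully_downr]. Qed.

Lemma above_role h u : u \in above -> fully_down [:: h] u -> role_full [:: h] u.
Proof. by move=> uU fd; split=> // uD; case/negP: (above_nbelow uU). Qed.

Lemma below_role h d : d \in below -> fully_up [:: h] d -> role_full [:: h] d.
Proof. by move=> dD fu; split=> // dU; case/negP: (above_nbelow dU). Qed.

Lemma host_one w a : w \notin A -> a \in A ->
  exists h, [/\ level h, role_full [:: h] w & hosts [:: h] a].
Proof.
move=> /nA_cases[wU|wD] aA.
  have [aw|naw] := boolP (le a w).
    exists (lower w w a); split; first exact: lower_level.
      by apply: above_role; rewrite //; apply: lower_down.
    by right; apply: lower_down2.
  exists (lower w a w); split; first exact: lower_level.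
    by apply: above_role; rewrite //; apply: lower_down.
  by left; apply: lower_up.
have [wa|nwa] := boolP (le w a).
  exists (raise w w a); split; first exact: raise_level.
    by apply: below_role; rewrite //; apply: raise_up.
  by left; apply: raise_up2.
exists (raise w a w); split; first exact: raise_level.
  by apply: below_role; rewrite //; apply: raise_up.
by right; apply: raise_down.
Qed.

(** The comparable [a2] goes to the same end as [w], the incomparable [a1] to the opposite end. *)
Lemma host_two w a1 a2 : w \notin A -> a1 \in A -> a2 \in A ->
    inc a1 w -> ~~ inc a2 w ->
  exists h, [/\ level h, role_full [:: h] w, hosts [:: h] a1 & hosts [:: h] a2].
Proof.
move=> /nA_cases[wU|wD] a1A a2A i1; rewrite negb_and !negbK.
  rewrite (negbTE (above_nle wU a2A)) orbF => a2w.
  exists (lower w a1 a2); split; first exact: lower_level.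
  - by apply: above_role; rewrite //; apply: lower_down.
  - by left; apply: lower_up => //; apply: incW.
  - by right; apply: lower_down2.
rewrite (negbTE (below_nle wD a2A)) /= => wa2.
exists (raise w a1 a2); split; first exact: raise_level.
- by apply: below_role; rewrite //; apply: raise_up.
- by right; apply: raise_down => //; apply: incW; rewrite inc_sym.
- by left; apply: raise_up2.
Qed.

Lemma host_many (ws l : seq T) : size l <= size ws ->
    {subset ws <= ~: A} -> {subset l <= A} ->
  exists H, [/\ size H = size ws, all level H,
    forall w, w \in ws -> role_full H w & forall a, a \in l -> hosts H a].
Proof.
elim: ws l => [|w ws IHws] l.
  by rewrite leqn0 size_eq0 => /eqP-> _ _; exists [::].
case: l => [|a l] /= leq wsA lA.
  exists (map role (w :: ws)); split=> //; first by rewrite size_map.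
    by rewrite all_map; apply/allP=> x _; apply: role_level.
  by move=> x; apply: role_fullP.
have [||H [sH lH rH hH]] := IHws l leq.
- by move=> x xw; apply: wsA; rewrite inE xw orbT.
- by move=> x xw; apply: lA; rewrite inE xw orbT.
have wA : w \notin A by have := wsA w (mem_head _ _); rewrite inE.
have [h [lh rh hh]] := host_one wA (lA a (mem_head _ _)).
exists (h :: H); split; rewrite /= ?sH ?lh //.
  move=> x; rewrite inE => /orP[/eqP->|/rH]; first exact: (@role_fulll [:: h] H).
  exact: (role_fullr [:: h]).
move=> x; rewrite inE => /orP[/eqP->|/hH]; first exact: (@hostsl [:: h] H).
exact: (hostsr [:: h]).
Qed.

Definition inc_part w := [set a in A | inc a w].
Definition comp_part w := [set a in A | ~~ inc a w].

(* Elements that can host two elements of A in a single level map. *)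
Definition mixed m w := (m <= #|inc_part w|) && (m <= #|comp_part w|).

(** Greedy: fewer than [m] elements of [A] are taken before each step, so both parts of a mixed [w]
    contain a fresh one. *)
Lemma host_double m (ws : seq T) : {subset ws <= ~: A} -> all (mixed m) ws ->
    2 * size ws <= m ->
  exists H (l : seq T), [/\ size H = size ws /\ size l = 2 * size ws,
    all level H, uniq l, {subset l <= A} &
    (forall w, w \in ws -> role_full H w) /\ (forall a, a \in l -> hosts H a)].
Proof.
elim: ws => [|w ws IHws] wsA /=; first by exists [::], [::].
move=> /andP[/andP[mi mc] mws] lem.
have [||| H [l [[sH sl] lH ul lA [rH hH]]]] := IHws.
- by move=> x xw; apply: wsA; rewrite inE xw orbT.
- by [].
- by move: lem; clear; lia.
have fresh (Y : {set T}) : m <= #|Y| -> exists2 a, a \in Y & a \notin l.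
  move=> mY; apply/exists_inP; apply: contraTT lem; rewrite negb_exists_in.
  move=> /forall_inP Yl; rewrite -ltnNge.
  suff : #|Y| <= size l by move: mY; rewrite sl; clear; lia.
  rewrite cardE; apply: uniq_leq_size; first exact: enum_uniq.
  by move=> x; rewrite mem_enum => /Yl; rewrite negbK.
have [a1 + a1l] := fresh _ mi; rewrite inE => /andP[a1A i1].
have [a2 + a2l] := fresh _ mc; rewrite inE => /andP[a2A i2].
have wA : w \notin A by have := wsA w (mem_head _ _); rewrite inE.
have [h [lh rh h1 h2]] := host_two wA a1A a2A i1 i2.
exists (h :: H), [:: a1, a2 & l]; split.
- by rewrite /= sH sl; split=> //; clear; lia.
- by rewrite /= lh.
- rewrite /= ul a2l inE negb_or a1l !andbT.
  by apply: contraTneq i1 => ->.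
- by move=> x; rewrite !inE => /or3P[/eqP->|/eqP->|/lA].
split=> x; rewrite !inE.
  by move=> /orP[/eqP->|/rH]; [apply: (@role_fulll [:: h] H)|apply: (role_fullr [:: h])].
move=> /or3P[/eqP->|/eqP->|/hH]; [exact: (@hostsl [:: h] H)|exact: (@hostsl [:: h] H)|].
exact: (hostsr [:: h]).
Qed.

Lemma card_nA : #|~: A| = #|above| + #|below|.
Proof. by apply/eqP; rewrite -(eqn_add2r #|A|) card_above_below addnC cardsC. Qed.

Lemma leq_card_bigcup_seq (I : eqType) (r : seq I) (F : I -> {set T}) m :
  (forall i, i \in r -> #|F i| <= m) -> #|\bigcup_(i <- r) F i| <= size r * m.
Proof.
elim: r => [|i r IHr] Fm; first by rewrite big_nil cards0.
rewrite big_cons mulSn; apply: leq_trans (leq_card_setU _ _) _.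
apply: leq_add; first by apply: Fm; rewrite mem_head.
by apply: IHr => j jr; apply: Fm; rewrite inE jr orbT.
Qed.

Lemma subset_seq (X : {set T}) q : q <= #|X| ->
  exists s : seq T, [/\ size s = q, uniq s & {subset s <= X}].
Proof.
move=> /exists_subset_card[Y sYX cY]; exists (enum Y).
by rewrite -cardE enum_uniq; split=> // x; rewrite mem_enum => /(subsetP sYX).
Qed.

(** [X] consists of the ends of a maximal family of disjoint incomparable pairs (u, d). One map
    lowers [u] and raises [d], so [pairs_saving] bounds the family. *)
Lemma incomparable_pairs n : dim_ge n -> exists X : {set T},
  [/\ #|X| + 2 * n <= 2 * #|~: A| + 4, X \subset ~: A
    & forall u d, u \in above :\: X -> d \in below :\: X -> le d u].
Proof.
move=> dim; pose E x y := [&& x \in above, y \in below & inc x y].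
have [|s [/allP Es us maxs]] := @maximal_matching _ E.
  by move=> x; rewrite /E /inc lexx !andbF.
have sA : {subset ends s <= ~: A}.
  move=> x; rewrite mem_cat inE => /orP[]/mapP[p /Es/and3P[pU pD _] ->].
    exact: above_nA.
  exact: below_nA.
exists [set x in ends s]; split.
- have := @pairs_saving n set0 s (fun p => lower p.1 p.2 p.1) dim us.
  rewrite cards0 setD0 => /(_ sA) ineq.
  rewrite cardsE (card_uniqP us) size_ends.
  suff: n + size s <= #|~: A| + 2 * 0 + 2 by clear; lia.
  apply: ineq => p /Es/and3P[pU pD pi]; split; first exact: lower_level.
    by apply: above_role => //; apply: lower_down.
  by apply: below_role => //; apply: lower_up => //; apply: incW; rewrite inc_sym.
- by apply/subsetP=> x; rewrite inE => /sA.
move=> u d /setDP[uU +] /setDP[dD +]; rewrite !in_set => us' ds'.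
apply: contraT => ndu; have := maxs u d.
rewrite /E uU dD /inc (above_below_nle uU dD) ndu.
by rewrite (negbTE us') (negbTE ds') => /(_ isT).
Qed.

(** Otherwise [merge_saving] with [q] pairs beats the dimension. The difficulty is to host all of
    [A] on few maps: either many mixed elements host two each, or the merged elements can be chosen
    unmixed, and then all but few elements of [A] relate to them uniformly. *)
Lemma above_or_below_small n c : dim_ge n -> #|T| <= 2 * n + c -> n <= #|A| ->
    1000 * (c.+1 * c.+1) <= n ->
  #|above| <= 20 * c + 57 \/ #|below| <= 20 * c + 57.
Proof.
move=> dim cT nA bign.
have [X [cX sXA dltu]] := incomparable_pairs dim.
have [?|bigU] := leqP #|above| (20 * c + 57); first by left.
have [?|bigD] := leqP #|below| (20 * c + 57); first by right.
(* [q] exceeds by one the 3c + 8 lost to [X] and to additive constants. [z] compensates for the 2q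
   merged elements and for the excess of [#|A| + #|X|] over [#|~: A|], at most 3c + 8. The threshold
   20c + 57 is z + 3q plus the bound 2c + 4 on [#|X|]. *)
exfalso; pose q := 3 * c + 9; pose z := 2 * q + 3 * c + 8.
have cA := card_above_below; have cnA := card_nA.
have cX' : #|X| <= 2 * c + 4 by move: cX cT nA cA cnA; clear; lia.
have nW : n <= #|~: A| + 2.
  have := @pairs_saving n set0 [::] (fun _ _ => 0) dim isT.
  by rewrite setD0 cards0 muln0 !addn0; apply.
have cUX : z + 3 * q <= #|above :\: X|.
  have := cardsID X above; have := subset_leq_card (subsetIr above X).
  by move: cX' bigU; rewrite /z /q; clear; lia.
have cDX : z + 3 * q <= #|below :\: X|.
  have := cardsID X below; have := subset_leq_card (subsetIr below X).
  by move: cX' bigD; rewrite /z /q; clear; lia.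
suff [cu [cd [H0 [[scu scd] [cuU cdD] [sH0 lH0] full0 hosted]]]] :
    exists cu cd H0, [/\ size cu = q /\ size cd = q,
      {subset cu <= above :\: X} /\ {subset cd <= below :\: X},
      size H0 + #|X| + 2 * q <= #|~: A| + 2 /\ all level H0,
      forall w, w \notin A -> w \notin X -> w \notin cu -> w \notin cd ->
        role_full H0 w
    & forall a, a \in A -> (forall u, u \in cu -> inc a u -> reverses H0 a u) \/
                          (forall d, d \in cd -> inc d a -> reverses H0 d a)].
  have := merge_saving dim _ cuU cdD dltu lH0 full0 hosted.
  rewrite scu scd => /(_ erefl).
  by move: sH0 cX' cT nA cA cnA; rewrite /q; clear; lia.
pose W := ~: A :\: X.
have cW : #|W| + #|X| = #|~: A|.
  by rewrite -(cardsID X (~: A)) addnC (setIidPr sXA).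
have rest cu cd : size cu = q -> size cd = q -> uniq cu -> uniq cd ->
    {subset cu <= above :\: X} -> {subset cd <= below :\: X} ->
    #|W :\: [set x in cu ++ cd]| + 2 * q = #|W|.
  move=> scu scd ucu ucd cuU cdD; rewrite -(cardsID [set x in cu ++ cd] W) addnC.
  congr (_ + _); rewrite (setIidPr _).
    rewrite cardsE (card_uniqP _) ?size_cat ?scu ?scd; first by clear; lia.
    rewrite cat_uniq ucu ucd andbT; apply/hasPn=> x /cdD/setDP[xD _].
    by apply/negP=> /cuU/setDP[xU _]; case/negP: (above_nbelow xU).
  apply/subsetP=> x; rewrite !inE mem_cat.
  by move=> /orP[/cuU/setDP[/above_nA-> ->]|/cdD/setDP[/below_nA-> ->]].
have hostedW H0 cu cd a : hosts H0 a ->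
    (forall u, u \in cu -> inc a u -> reverses H0 a u) \/
    (forall d, d \in cd -> inc d a -> reverses H0 d a).
  case=> fa; [left=> u _ /incW|right=> d _ /incW]; exact: fa.
pose Mx := [set w in W | mixed (2 * z) w].
have [bigM|smallM] := leqP (z + 2 * q) #|Mx|.
  have [|cu [scu ucu cuU]] := @subset_seq (above :\: X) q.
    by move: cUX; clear; lia.
  have [|cd [scd ucd cdD]] := @subset_seq (below :\: X) q.
    by move: cDX; clear; lia.
  pose C := [set x in cu ++ cd].
  have cC : #|C| <= 2 * q.
    by rewrite cardsE (leq_trans (card_size _)) // size_cat scu scd; clear; lia.
  have [|ws [sws uws wsM]] := @subset_seq (Mx :\: C) z.
    have := cardsID C Mx; have := subset_leq_card (subsetIr Mx C).
    by move: cC bigM; clear; lia.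
  have wsA : {subset ws <= ~: A}.
    by move=> x /wsM/setDP[]; rewrite !inE => /andP[/andP[_ ->]].
  have wsmix : all (mixed (2 * z)) ws.
    by apply/allP=> x /wsM/setDP[]; rewrite inE => /andP[].
  have [|H1 [l [[sH1 sl] lH1 ul lA [rH1 hH1]]]] := host_double wsA wsmix.
    by rewrite sws.
  pose W1 := (W :\: C) :\: [set x in ws].
  pose A1 := A :\: [set x in l].
  have cW1 : #|W1| + z = #|W :\: C|.
    rewrite -(cardsID [set x in ws] (W :\: C)) addnC; congr (_ + _).
    rewrite (setIidPr _) ?cardsE ?(card_uniqP uws) ?sws //.
    apply/subsetP=> x; rewrite inE => /wsM; rewrite !inE.
    by move=> /andP[-> /andP[->]].
  have cA1 : #|A1| + 2 * z = #|A|.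
    rewrite -(cardsID [set x in l] A) addnC; congr (_ + _).
    rewrite (setIidPr _) ?cardsE ?(card_uniqP ul) ?sl ?sws //.
    by apply/subsetP=> x; rewrite inE => /lA.
  have cWC := rest cu cd scu scd ucu ucd cuU cdD.
  have [|||H2 [sH2 lH2 rH2 hH2]] := @host_many (enum W1) (enum A1).
  - rewrite -!cardE; move: cA1 cW1 cWC cW cX' nW cT nA cA cnA; rewrite -/C.
    by rewrite /z /q; clear; lia.
  - by move=> x; rewrite mem_enum !inE => /and4P[_ _ _].
  - by move=> x; rewrite mem_enum !inE => /andP[].
  exists cu, cd, (H1 ++ H2); split=> //.
  - rewrite all_cat lH1 lH2 size_cat sH1 sH2 sws -cardE; split=> //.
    by move: cW1 cWC cW; rewrite -/C; clear; lia.
  - move=> w wA wX wu wd; have [wws|wws] := boolP (w \in ws).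
      by apply/role_fulll/rH1.
    apply/role_fullr/rH2; rewrite mem_enum !inE wws wX wA mem_cat.
    by rewrite (negbTE wu) (negbTE wd).
  move=> a aA; apply: hostedW; have [al|al] := boolP (a \in l).
    by apply/hostsl/hH1.
  by apply/hostsr/hH2; rewrite mem_enum !inE al.
have nonmixed (Y : {set T}) : z + 3 * q <= #|Y| -> q <= #|Y :\: Mx|.
  have := cardsID Mx Y; have := subset_leq_card (subsetIr Y Mx).
  by move: smallM; clear; lia.
have [cu [scu ucu cuN]] := subset_seq (nonmixed _ cUX).
have [cd [scd ucd cdN]] := subset_seq (nonmixed _ cDX).
have cuU : {subset cu <= above :\: X} by move=> x /cuN/setDP[].
have cdD : {subset cd <= below :\: X} by move=> x /cdN/setDP[].
pose C := [set x in cu ++ cd].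
pose minority w := if #|inc_part w| < 2 * z then inc_part w else comp_part w.
have cmin w : w \in cu ++ cd -> #|minority w| <= 2 * z.
  move=> wC; have wM : w \notin Mx.
    by move: wC; rewrite mem_cat => /orP[/cuN|/cdN]/setDP[].
  have wW : w \in W.
    rewrite !inE; move: wC; rewrite mem_cat.
    by move=> /orP[/cuU/setDP[/above_nA-> ->]|/cdD/setDP[/below_nA-> ->]].
  rewrite /minority; case: ltnP => [/ltnW //|big].
  by move: wM; rewrite inE wW /mixed big /= -ltnNge => /ltnW.
pose A0 := \bigcup_(w <- cu ++ cd) minority w.
have A0P w a : w \in cu ++ cd -> a \notin A0 -> a \notin minority w.
  by move=> wC; apply: contra => am; rewrite /A0 (big_rem w) //= inE am.
have cA0 : #|A0| <= (q + q) * (2 * z).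
  by have := leq_card_bigcup_seq cmin; rewrite size_cat scu scd.
have A0A : {subset enum A0 <= A}.
  move=> a; rewrite mem_enum; apply: contraTT => naA; rewrite /A0.
  apply: (big_ind (fun Y : {set T} => a \notin Y)); first by rewrite inE.
    by move=> Y Y' aY aY'; rewrite inE negb_or aY.
  by move=> w _; rewrite /minority; case: ifP => _; rewrite inE (negbTE naA).
have cWC := rest cu cd scu scd ucu ucd cuU cdD.
have [|||H1 [sH1 lH1 rH1 hH1]] := @host_many (enum (W :\: C)) (enum A0).
(* Room for the up to 4qz elements of [A0] is what requires [n] to be at least 1000(c + 1)^2. *)
- rewrite -!cardE; move: cA0 cWC cW cX' nW bign; rewrite -/C.
  rewrite /z /q; clear; nia.
- by move=> x; rewrite mem_enum !inE => /and3P[_ _].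
- exact: A0A.
(* Outside [A0] one map suffices: by [homog], a [u] in [cu] incomparable to one element of
   [A :\: A0] is above none of them. *)
pose zup : T -> nat := fun x => [exists a in A :\: A0, le a x].
have lzup : level zup.
  apply/levelP=> x y xy; rewrite /zup.
  case: (boolP [exists a in _, le a x]) => // /exists_inP[a aA ax].
  rewrite (_ : [exists a in _, le a y]) //; apply/exists_inP; exists a => //.
  exact: le_tr ax xy.
have homog w a a' : w \in cu ++ cd -> a \in A :\: A0 -> a' \in A :\: A0 ->
    inc a w -> inc a' w.
  move=> wC /setDP[aA aA0] /setDP[a'A a'A0] aw.
  have := A0P w a wC aA0; have := A0P w a' wC a'A0; rewrite /minority.
  case: ifP => _; rewrite !inE aA a'A /= ?aw //.
  by rewrite negbK.
exists cu, cd, (H1 ++ [:: zup]); split=> //.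
- rewrite all_cat lH1 /= lzup size_cat /= sH1 -cardE; split=> //.
  by move: cWC cW; rewrite -/C; clear; lia.
- move=> w wA wX wu wd; apply/role_fulll/rH1.
  by rewrite mem_enum !inE wX wA mem_cat (negbTE wu) (negbTE wd).
move=> a aA; have [aA0|aA0] := boolP (a \in A0).
  by apply/hostedW/hostsl/hH1; rewrite mem_enum.
have aZ : a \in A :\: A0 by rewrite inE aA0.
left=> u ucu' au; rewrite reverses_cat; apply/orP; right.
rewrite /reverses /= /zup (_ : [exists a' in _, le a' a]); last first.
  by apply/exists_inP; exists a; rewrite ?lexx.
rewrite orbF ltnS leqn0 eqb0.
apply/exists_inPn=> a' a'Z; apply: incW; apply: homog aZ a'Z au.
by rewrite mem_cat ucu'.
Qed.

Definition standard_family d (a b : 'I_d -> T) :=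
  [/\ forall i j, le (a i) (b j) = (i != j), forall i j, ~~ le (b j) (a i),
      forall i j, le (a i) (a j) -> i = j & forall i j, le (b i) (b j) -> i = j].

(** * Height two and the bipartite incomparability graph *)

Section HeightTwo.
Variable B : {set T}.
Hypothesis sBU : B \subset above.
Hypothesis antiB : {in B &, forall x y, le x y -> x = y}.

Let S : finType := {x | x \in A}.
Let R : finType := {x | x \in B}.
Let g (s : S) (t : R) := ~~ le (val s) (val t).

(** Taking maxima over the points below forces monotonicity; for a chain graph of [g] the values on
    [A] and [B] do not change. *)
Definition extend (f : (S -> nat) * (R -> nat)) : T -> nat := fun z =>
  maxn (\max_(s | le (val s) z) f.1 s) (\max_(t | le (val t) z) f.2 t).

Lemma extend_level f : level (extend f).
Proof.
have sub (I : finType) (P Q : pred I) (F : I -> nat) : subpred P Q ->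
    \max_(i | P i) F i <= \max_(i | Q i) F i.
  by move=> sPQ; apply/bigmax_leqP=> i /sPQ Qi; apply: leq_bigmax_cond.
apply/levelP=> x y xy; rewrite /extend geq_max !leq_max.
by rewrite !sub ?orbT // => s /le_tr; apply.
Qed.

Lemma extend_l f (s : S) : extend f (val s) = f.1 s.
Proof.
rewrite /extend (big_pred1 s) => [|s']; last first.
  apply/idP/eqP => [/antiA H|->]; last exact: lexx.
  by apply/val_inj/H; apply: valP.
rewrite big_pred0 ?maxn0 // => t; apply/negbTE/above_nle; last exact: valP.
exact: (subsetP sBU) (valP t).
Qed.

Lemma extend_r f (t : R) : chain_level g f -> extend f (val t) = f.2 t.
Proof.
move/chain_levelP=> lh; rewrite /extend [X in maxn _ X](big_pred1 t) => [|t'].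
  by apply/maxn_idPr/bigmax_leqP=> s st; apply: lh; rewrite negbK.
apply/idP/eqP => [/antiB H|->]; last exact: lexx.
by apply/val_inj/H; apply: valP.
Qed.

(** A chain cover [L] of [g] gives [size L + 4 + 2 * #|X|] level maps: the extensions of [L], two
    opposite orders of [B], and the cost in [dim_le_del]. This explains [N], and [k] makes
    [#|S| + #|R| < 2 * N + k] true. *)
Lemma height_two n c : dim_ge n -> #|T| <= 2 * n + c ->
  exists d (a b : 'I_d -> T), standard_family a b /\
    (let x := #|~: (A :|: B)| in let k := c + 9 + 4 * x in
     n <= d + (4 + 2 * x + 2 * (5000 * (k * k)))).
Proof.
move=> dim cT; set X := ~: (A :|: B); pose N := n - (4 + 2 * #|X|).
have XP y : y \notin X -> y \in A \/ y \in B.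
  by rewrite !inE negbK => /orP.
have hardN : chain_cover_ge g N.
  move=> L lL covL; pose n0 := #|{: R}|.
  pose r1 : (S -> nat) * (R -> nat) := (fun=> 0, fun t => (enum_rank t).+1).
  pose r2 : (S -> nat) * (R -> nat) := (fun=> 0, fun t => n0 - enum_rank t).
  have lL' : all (chain_level g) (L ++ [:: r1; r2]).
    by rewrite all_cat lL /= andbT; apply/andP; split; apply/chain_levelP.
  suff : n <= size (map extend (L ++ [:: r1; r2])) + 2 * #|X| + 2.
    by rewrite size_map size_cat /= /N; clear; lia.
  apply: dim_le_del => //.
  - by elim: (L ++ _) => //= f l ->; rewrite extend_level.
  - move=> u y /setDP[uU /XP[uA|uB]]; first by case/negP: (above_nA uU).
    have [t tu] : exists t : R, val t = u by exists (Sub u uB); rewrite SubK.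
    move=> /XP[yA|yB] yu; last first.
      have [t' ty] : exists t : R, val t = y by exists (Sub y yB); rewrite SubK.
      rewrite map_cat reverses_cat; apply/orP; right; rewrite /reverses /= orbF.
      rewrite -tu -ty !extend_r; try by apply/chain_levelP.
      have : enum_rank t' != enum_rank t :> nat.
        apply: contraTneq yu => /ord_inj/enum_rank_inj tt'.
        by rewrite -tu -ty tt' /inc lexx.
      rewrite /= ltnS neq_ltn => /orP[lt|->] //.
      by rewrite ltn_sub2l ?orbT // ltn_ord.
    have [s sy] : exists s : S, val s = y by exists (Sub y yA); rewrite SubK.
    have gst : g s t by rewrite /g sy tu; case/andP: yu.
    have := covL s t gst; rewrite map_cat reverses_cat => cst.
    apply/orP; left; rewrite -sy -tu; move: cst lL; rewrite /covered /reverses.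
    elim: L {lL' covL} => //= h L IHL.
    move=> /orP[lt /andP[lh _]|/IHL{}IHL /andP[_ /IHL->]]; last by rewrite orbT.
    by rewrite extend_l extend_r // lt.
  - move=> d y /setDP[dD /XP[dA|dB]]; first by case/negP: (below_nA dD).
    by case/negP: (above_nbelow (subsetP sBU _ dB)).
have cST : #|{: S}| + #|{: R}| + #|X| = #|T|.
  have -> : #|{: S}| = #|A| by rewrite card_sig; apply: eq_card.
  have -> : #|{: R}| = #|B| by rewrite card_sig; apply: eq_card.
  rewrite -(cardsC (A :|: B)) -/X; congr (_ + _); rewrite cardsU.
  have -> : A :&: B = set0; last by rewrite cards0 subn0.
  apply/setP=> x; rewrite !inE; apply/negP=> /andP[xA xB].
  by case/negP: (above_nA (subsetP sBU _ xB)).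
pose k := c + 9 + 4 * #|X|.
have k0 : 0 < k by rewrite /k; clear; lia.
have [|sq [usq gsq Nsq]] := induced_matching hardN k0.
  have arith (p q x t : nat) : p + q + x = t -> t <= 2 * n + c ->
    p + q < 2 * (n - (4 + 2 * x)) + (c + 9 + 4 * x) by clear; lia.
  exact: arith cST cT.
pose a (i : 'I_(size sq)) := val (tnth (in_tuple sq) i).1.
pose b (i : 'I_(size sq)) := val (tnth (in_tuple sq) i).2.
exists (size sq), a, b; split; last first.
  have arith (x y d : nat) : n - (4 + 2 * x) <= d + y -> n <= d + (4 + 2 * x + y).
    by clear; lia.
  exact: arith Nsq.
have tnthE i j : (tnth (in_tuple sq) i == tnth (in_tuple sq) j) = (i == j).
  by apply/eqP/eqP => [|-> //]; apply/tuple_uniqP.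
have ab i j : le (a i) (b j) = (i != j).
  by apply: negb_inj; rewrite negbK -tnthE -gsq ?mem_tnth.
have bU i : b i \in above by apply: (subsetP sBU); apply: valP.
split=> // i j.
- by apply: above_nle (bU j) _; apply: valP.
- move=> aij; apply/eqP; apply: contraT => nij.
  have := ab i i; rewrite eqxx => /= <-; apply: le_tr aij _.
  by rewrite ab eq_sym.
- move=> bij; apply/eqP; apply: contraT => nij.
  have := ab j j; rewrite eqxx => /= <-; apply: le_tr bij.
  by rewrite ab eq_sym.
Qed.

End HeightTwo.

(** Two comparable points u < u' above [A] can be lowered by one map, so a maximal family of such
    disjoint pairs is small. Removing it together with [below] leaves height two. *)
Lemma standard_family_of_below n c m : dim_ge n -> #|T| <= 2 * n + c ->
    n <= #|A| -> #|below| <= m ->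
  exists d (a b : 'I_d -> T), standard_family a b /\
    (let x := 3 * m + 2 * c + 4 in let k := c + 9 + 4 * x in
     n <= d + (4 + 2 * x + 2 * (5000 * (k * k)))).
Proof.
move=> dim cT nA mD.
pose E x y := [&& x \in above, y \in above, x != y & le x y].
have [|s [/allP Es us maxs]] := @maximal_matching _ E.
  by move=> x; rewrite /E eqxx !andbF.
have sU : {subset ends s <= above}.
  by move=> x; rewrite mem_cat => /orP[]/mapP[p /Es/and4P[p1 p2 _ _] ->].
pose B := above :\: [set x in ends s].
have cU := card_above_below.
have cs : n + size s <= #|above| + 2 * #|below| + 2.
  have -> : above = ~: A :\: below.
    apply/setP=> x; rewrite in_setD in_setC; apply/idP/andP => [xU|[xD xA]].
      by rewrite above_nbelow ?above_nA.
    by have [xA'|//|xD'] := antichain_cases x; rewrite ?xA' ?xD' in xA xD.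
  apply: (@pairs_saving n below s (fun p => lower p.2 p.2 p.1)) => //.
    by move=> x /sU xU; rewrite !in_setD in_setC above_nbelow ?above_nA.
  move=> p /Es/and4P[p1 p2 _ p12]; split; first exact: lower_level.
    by apply: above_role => //; apply: lower_down2.
  by apply: above_role => //; apply: lower_down.
have cX : #|~: (A :|: B)| <= 3 * m + 2 * c + 4.
  have sX : ~: (A :|: B) \subset below :|: [set x in ends s].
    apply/subsetP=> x; rewrite in_setC in_setU negb_or in_setU in_set => /andP[xA].
    have [xA'|xU|->] := antichain_cases x; first by rewrite xA' in xA.
      by rewrite in_setD xU andbT in_set negbK => ->; rewrite orbT.
    by [].
  have := leq_trans (subset_leq_card sX) (leq_card_setU _ _).
  rewrite [#|[set x in _]|]cardsE (card_uniqP us) size_ends.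
  by move: cs cU cT nA mD; clear; lia.
have [||d [a [b [std le_d]]]] := @height_two B _ _ n c dim cT.
- exact: subsetDl.
- move=> x y /setDP[xU +] /setDP[yU +] xy; rewrite !in_set => xs ys.
  apply/eqP; apply: contraT => nxy; have := maxs x y.
  by rewrite /E xU yU nxy xy (negbTE xs) (negbTE ys) => /(_ isT).
exists d, a, b; split; first exact: std.
move: le_d cX; cbv zeta.
move: #|_| (3 * m + _ + _) => x y; clear=> H xy.
have : (c + 9 + 4 * x) * (c + 9 + 4 * x) <= (c + 9 + 4 * y) * (c + 9 + 4 * y).
  by apply: leq_mul; lia.
lia.
Qed.

End Antichain.
End Levels.

(** * Dilworth's theorem: a large antichain *)

Section Dilworth.
Variables (T : finType) (le : rel T).
Hypotheses (lexx : reflexive le) (le_anti : antisymmetric le) (le_tr : transitive le).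

Definition antichain (A : {set T}) :=
  [forall x in A, forall y in A, le x y ==> (x == y)].

Lemma antichainP (A : {set T}) :
  reflect {in A &, forall x y, le x y -> x = y} (antichain A).
Proof.
apply: (iffP forall_inP) => [anti x y xA yA xy|anti x xA].
  by apply/eqP; move/forall_inP/(_ y yA)/implyP: (anti x xA); apply.
by apply/forall_inP=> y yA; apply/implyP=> xy; apply/eqP; apply: anti.
Qed.

(* Dilworth's theorem in the form width >= dim: a maximum matching of the   *)
(* strict comparability relation links the elements into #|T| - #|M| chains.*)
Lemma large_antichain n : dim_ge le n ->
  exists A : {set T}, antichain A /\ n <= #|A|.
Proof.
move=> dim; pose E := [set p : T * T | (p.1 != p.2) && le p.1 p.2].
have [M [X [Y [sME [M1 M2] /vertex_coverP cXY leM]]]] := konig E.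
exists (~: (X :|: Y)); split.
  apply/antichainP=> x y; rewrite !inE !negb_or => /andP[xX _] /andP[_ yY] xy.
  apply/eqP; apply: contraT => nxy; have := cXY (x, y).
  by rewrite inE /= nxy xy (negbTE xX) (negbTE yY) => /(_ isT).
have leA : #|T| <= #|~: (X :|: Y)| + #|M|.
  rewrite -(cardsC (X :|: Y)) addnC leq_add2l.
  exact: leq_trans (leq_card_setU _ _) leM.
have ltM p : p \in M -> p.1 != p.2 /\ le p.1 p.2.
  by move/(subsetP sME); rewrite inE => /andP[].
(* The successor of [x] in its chain; the last element of a chain is a fixed point. *)
pose f x := if [pick y | (x, y) \in M] is Some y then y else x.
have fE p : p \in M -> f p.1 = p.2.
  case: p => x y /= xyM; rewrite /f; case: pickP => [y' xy'M|/(_ y)].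
    by have [] := M1 _ _ xy'M xyM erefl.
  by rewrite xyM.
have le_f x : le x (f x).
  by rewrite /f; case: pickP => [y /ltM[]|_].
have le_iter i x : le x (iter i f x).
  by elim: i => [|i IHi]; [apply: lexx|apply: le_tr IHi (le_f _)].
have chain x y z : fconnect f x y -> fconnect f x z -> le y z || le z y.
  move=> /iter_findex<- /iter_findex<-.
  have [/subnK<-|/ltnW/subnK<-] := leqP (findex f x y) (findex f x z);
    by rewrite iterD le_iter ?orbT.
pose Src := ~: [set p.2 | p in M].
(* If [y] is on the chain from [x] and is not below [z], then fewer elements of that chain lie below
   [z] than below [y]. *)
pose h x : T -> nat := fun z => #|[set y | fconnect f x y && le y z]|.
have cSrc : #|Src| + #|M| = #|T|.
  by rewrite -(card_in_imset M2) addnC cardsC.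
suff : n <= size (map h (enum Src)).
  by rewrite size_map -cardE; move: cSrc leA; clear; lia.
have src y : exists2 x, x \in Src & fconnect f x y.
  have [m] := ubnP #|[set z | le z y]|; elim: m y => // m IHm y ltm.
  have [|nyM] := boolP (y \in [set p.2 | p in M]); last first.
    by exists y; rewrite ?inE ?connect0.
  case/imsetP=> p pM yp; have [np lep] := ltM p pM.
  have [|x xS xp] := IHm p.1; last first.
    exists x => //; apply: connect_trans xp _; rewrite yp -(fE p pM).
    exact: fconnect1.
  apply: leq_trans (_ : #|[set z | le z y]| <= _) => //.
  apply/proper_card/properP; split.
    by apply/subsetP=> z; rewrite !inE yp => zp; apply: le_tr zp lep.
  exists y; rewrite !inE ?lexx // yp; apply: contra np => pp.
  by apply/eqP/le_anti; rewrite lep pp.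
apply: dim => [|y z /andP[nyz nzy]].
  rewrite all_map; apply/allP=> x _; apply/levelP=> y z yz.
  apply/subset_leq_card/subsetP=> w; rewrite !inE => /andP[-> wy].
  exact: le_tr wy yz.
have [x xS xy] := src y; rewrite -mem_enum in xS.
apply: (reverses_map xS); apply/proper_card/properP; split.
  apply/subsetP=> w; rewrite !inE => /andP[xw wz]; rewrite xw.
  have [//|yw] := orP (chain _ _ _ xw xy).
  by case/negP: nyz; apply: le_tr yw wz.
by exists y; rewrite !inE xy ?lexx.
Qed.

Lemma maximal_antichain n : dim_ge le n -> exists A : {set T},
  [/\ {in A &, forall x y, le x y -> x = y},
      forall x, x \notin A -> exists2 a, a \in A & le a x || le x a
    & n <= #|A|].
Proof.
move=> /large_antichain[A0 [A0P nA0]].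
case: (arg_maxnP (fun A : {set T} => #|A|) A0P) => A /antichainP AP maxA.
exists A; split=> //; last exact: leq_trans nA0 (maxA _ A0P).
move=> x nxA; apply/exists_inP; apply: contraT; rewrite negb_exists_in.
move=> /forall_inP nx; have := maxA (x |: A); rewrite /= cardsU1 nxA ltnn; apply.
apply/antichainP=> y z; rewrite !inE => /orP[/eqP->|yA] /orP[/eqP->|zA] //.
- by move=> xz; have := nx z zA; rewrite xz orbT.
- by move=> yx; have := nx y yA; rewrite yx.
- exact: AP.
Qed.

End Dilworth.

(** * Order duality and the general case *)

Lemma dim_ge_dual (T : finType) (le : rel T) n :
  dim_ge le n -> dim_ge (fun x y => le y x) n.
Proof.
move=> dim H lH revH.
pose flip (h : T -> nat) : T -> nat := fun z => \max_y h y - h z.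
have ub (h : T -> nat) z : h z <= \max_y h y by apply: leq_bigmax.
rewrite -(size_map flip); apply: dim => [|x y /andP[nxy nyx]].
  rewrite all_map; apply: sub_all lH => h /levelP lh; apply/levelP=> x y xy.
  by rewrite /flip leq_sub2l //; apply: lh.
have := revH y x; rewrite /inc nxy nyx => /(_ isT).
rewrite /reverses has_map; apply: sub_has => h lt /=.
by rewrite /flip ltn_sub2l // (leq_trans lt) // ub.
Qed.

(** The loss in [standard_family_of_below] for m = 20c + 57, the bound from
    [above_or_below_small]. *)
Definition loss c :=
  let x := 3 * (20 * c + 57) + 2 * c + 4 in let k := c + 9 + 4 * x in
  4 + 2 * x + 2 * (5000 * (k * k)).

Lemma large_standard_family (T : finType) (le : rel T) n c :
    reflexive le -> antisymmetric le -> transitive le ->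
    dim_ge le n -> #|T| <= 2 * n + c -> 1000 * (c.+1 * c.+1) <= n ->
  exists d (a b : 'I_d -> T), standard_family le a b /\ n <= d + loss c.
Proof.
move=> lexx le_anti le_tr dim cT bign.
have [A [antiA maxA nA]] := maximal_antichain lexx le_anti le_tr dim.
have [smallU|smallD] := above_or_below_small lexx le_anti le_tr antiA maxA
  dim cT nA bign; last first.
  exact: (standard_family_of_below lexx le_anti le_tr antiA maxA dim cT nA smallD).
pose ge x y := le y x.
have gexx : reflexive ge by [].
have ge_anti : antisymmetric ge by move=> x y; rewrite andbC => /le_anti.
have ge_tr : transitive ge by move=> y x z xy yz; apply: le_tr yz xy.
have antiA' : {in A &, forall x y, ge x y -> x = y}.
  by move=> x y xA yA /(antiA _ _ yA xA).
have maxA' x : x \notin A -> exists2 a, a \in A & ge a x || ge x a.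
  by case/maxA=> a aA cmp; exists a; rewrite // orbC.
(* For [ge] the set [below] is convertible to the former [above], so [smallU] applies; [a] and [b]
   then change places. *)
have [d [a [b [[ab nba aa bb] le_d]]]] := standard_family_of_below gexx ge_anti
  ge_tr antiA' maxA' (dim_ge_dual dim) cT nA smallU.
exists d, b, a; split=> //; split=> i j.
- by rewrite -[LHS]/(ge (a j) (b i)) ab eq_sym.
- exact: nba.
- by move/bb.
- by move/aa.
Qed.

(** * From level maps to realizers and poset dimension *)

Section Realizer.
Import Order.TTheory.
Variables (disp : Order.disp_t) (P : finPOrderType disp).
Let le : rel P := fun x y => (x <= y)%O.

(** Ties of [h] are broken by the order of [P], and [szpilrajn] completes the resulting strict
    order. *)
Lemma linear_extension_of_level (h : P -> nat) : level le h ->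
  exists L : {set P * P}, linear_extension L /\
    forall x y, h x < h y -> (x, y) \in L.
Proof.
move/levelP=> lh.
pose S := [set p : P * P | (h p.1 < h p.2) || (h p.1 == h p.2) && (p.1 < p.2)%O].
have [|||L linL sub] := @szpilrajn _ P S.
- by move=> x; rewrite inE ltnn ltxx andbF.
- move=> x y z; rewrite !inE /= => /orP[xy|/andP[/eqP-> xy]].
    by case/orP=> [/(ltn_trans xy)-> //|/andP[/eqP<- _]]; rewrite xy.
  by case/orP=> [-> //|/andP[-> /(lt_trans xy)->]]; rewrite orbT.
- move=> x y xy; rewrite inE /= xy andbT orbC -leq_eqVlt; apply: lh.
  exact: ltW.
by exists L; split=> // x y xy; apply: (subsetP sub); rewrite inE xy.
Qed.

Lemma poset_dim_le (H : seq (P -> nat)) : 0 < size H -> all (level le) H ->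
  (forall x y, inc le x y -> reverses H x y) -> poset_dim P <= size H.
Proof.
move=> H0 /all_nthP lH revH; rewrite /poset_dim; case: ex_minnP => d _; apply.
rewrite /has_realizer H0 /=.
have ex (i : 'I_(size H)) : exists L : {set P * P}, linear_extension L /\
    forall x y, nth (fun=> 0) H i x < nth (fun=> 0) H i y -> (x, y) \in L.
  by apply: linear_extension_of_level; apply: lH.
have [L LP] := fin_all_exists ex.
apply/existsP; exists [ffun i => L i]; apply/andP; split.
  by apply/forallP=> i; rewrite ffunE; case: (LP i).
apply/forallP=> x; apply/forallP=> y; apply/eqP.
have linL i := linear_extensionP _ (proj1 (LP i)).
apply/idP/forallP=> [xy i|Lxy]; first by rewrite ffunE; case: (linL i) => _ _ _; apply.
have nL i : (y, x) \notin L i.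
  case: (linL i) => irr tr _ _; apply/negP=> yx; case/negP: (irr x).
  by apply: tr yx; have := Lxy i; rewrite ffunE.
have i0 : 'I_(size H) := Ordinal H0.
have nxy : x != y.
  apply: contraTneq (Lxy i0) => ->; rewrite ffunE; case: (linL i0).
  by move=> irr _ _ _; apply: irr.
rewrite lt_neqAle nxy /=; apply: contraT => nle.
have [yx|nyx] := boolP (y <= x)%O.
  case/negP: (nL i0); case: (linL i0) => _ _ _; apply.
  by rewrite lt_neqAle eq_sym nxy.
have : reverses H x y by apply: revH; rewrite /inc nle.
case/(has_nthP (fun=> 0)) => i lti lt.
by case/negP: (nL (Ordinal lti)); case: (LP (Ordinal lti)) => _; apply.
Qed.

Lemma dim_ge_poset n : 1 < n -> n <= poset_dim P -> dim_ge le n.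
Proof.
move=> n1 nP [|h H] lH revH; last exact: leq_trans nP (poset_dim_le _ lH revH).
(* An empty list means that no pair is incomparable; then one constant map bounds the dimension by
   1, against [1 < n]. *)
suff /(leq_trans nP) : poset_dim P <= size [:: (fun _ : P => 0)].
  by rewrite leqNgt n1.
by apply: poset_dim_le => //=; rewrite andbT; apply/levelP.
Qed.

Lemma contains_standard d (a b : 'I_d -> P) :
  standard_family le a b -> contains_poset P (standard_example d).
Proof.
case=> ab nba aa bb.
pose f (x : standard_example d) := match x with inl i => a i | inr j => b j end.
have fle : {mono f : x y / (x <= y)%O}.
  case=> i [] j; rewrite /Order.le /=.
  - by apply/idP/eqP => [/aa->|[->]] //; apply: lexx.
  - exact: ab.
  - by apply/negbTE; apply: nba.
  - by apply/idP/eqP => [/bb->|[->]] //; apply: lexx.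
by exists f => // x y fxy; apply/le_anti; rewrite -!fle fxy lexx.
Qed.

End Realizer.

(** * The quadratic bound and the conclusion *)

Lemma loss_quadratic c : 0 < c ->
  c + loss (2 * c + 1) <= (2 * (5000 * (1456 * 1456)) + 1000) * c ^ 2.
Proof.
move=> c0; rewrite /loss; set x := 3 * _ + _ + _; set k := _ + _ + 4 * x.
have cc : c <= c * c by rewrite leq_pmulr.
(* Here x = 124c + 237 and k = 4x + 2c + 10; c >= 1 absorbs the constants. *)
have xc : x <= 361 * c by rewrite /x; lia.
have kc : k <= 1456 * c by rewrite /k /x; lia.
have kk : k * k <= 1456 * c * (1456 * c) by apply: leq_mul.
rewrite -mulnn; clearbody k x; move: xc kk cc c0; clear; lia.
Qed.

Theorem theorem1p3 :
  exists (K : nat) (f : nat -> nat),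
    [/\ 0 < K,
        forall c : nat, 0 < c -> 0 < f c <= K * c ^ 2
      & forall (c n : nat) (disp : Order.disp_t) (P : finPOrderType disp),
          0 < c -> 10 * f c < n ->
          #|P| <= 2 * n + 1 -> n - c <= poset_dim P ->
          exists d : nat,
            [/\ 2 <= d, n - f c <= d
              & contains_poset P (standard_example d)]].
Proof.
pose K := 2 * (5000 * (1456 * 1456)) + 1000.
exists K, (fun c => K * c ^ 2).
(* Enough for the size condition: 1000(2c + 2)^2 <= 16000 c^2, while n > 40000 c^2. *)
have K0 : 4000 <= K by rewrite /K; lia.
have lossK c : 0 < c -> c + loss (2 * c + 1) <= K * c ^ 2 by apply: loss_quadratic.
clearbody K; split; first by move: K0; clear; lia.
  by move=> c c0; rewrite leqnn andbT muln_gt0 expn_gt0 c0; move: K0; clear; lia.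
move=> c n disp P c0 bign cP dimP.
have Kc : 4000 * (c * c) <= K * c ^ 2 by rewrite -mulnn leq_mul.
have cc : c <= c * c by rewrite leq_pmulr.
have n2 : 1 < n - c by move: Kc bign c0 cc; clear; lia.
have dim := dim_ge_poset n2 dimP.
have cP' : #|P| <= 2 * (n - c) + (2 * c + 1) by move: n2 cP; clear; lia.
have big : 1000 * ((2 * c + 1).+1 * (2 * c + 1).+1) <= n - c.
  by move: Kc bign c0 cc; clear; lia.
have [||| d [a [b [std le_d]]]] := large_standard_family _ _ _ dim cP' big.
- exact: Order.POrderTheory.lexx.
- exact: Order.POrderTheory.le_anti.
- exact: Order.POrderTheory.le_trans.
have := lossK c c0; move: le_d; move: (loss _) => l le_d le_l.
exists d; split; last exact: contains_standard std.
  by move: le_d le_l bign n2; clear; lia.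
by move: le_d le_l; clear; lia.
Qed.
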